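(* Let $M$ be a surface and let $f,\hat f:M\to\mathbb{R}^n$ be immersions which envelope a full conformal Ribaucour $2$-sphere congruence $S$, and suppose that $f$ and $\hat f$ have no umbilic points in common. Then $(f,\hat f)$ is a Darboux pair, i.e. with $g=\hat f-f$, $$df\wedge g^{-1}\,d\hat f\,g^{-1}=0 .$$
   Context: $C\ell_n$ is the real Clifford algebra of Euclidean $\mathbb{R}^n$, with $vw+wv=-2(v,w)1$ for $v,w\in\mathbb{R}^n$; nonzero vectors are invertible. For $C\ell_n$-valued 1-forms, $(\alpha\wedge\beta)(X,Y)=\alpha(X)\beta(Y)-\alpha(Y)\beta(X)$. All maps are smooth, $M$ is connected and $g=\hat f-f$ is nowhere zero. Let $\mathbb{R}^{n+1,1}=\mathbb{R}^n\oplus\langle v_0,v_\infty\rangle$ (orthogonal sum) be Lorentzian space, with $v_0,v_\infty$ light-like and $(v_0,v_\infty)=-\tfrac12$. A congruence of $2$-spheres is a map $S:M\to G^+_{n-2}(\mathbb{R}^{n+1,1})$ into the Grassmannian of $(n-2)$-planes on which the inner product is positive definite; the plane $S(p)$ represents the $2$-sphere (or plane) $\{x\in\mathbb{R}^n\cup\{\infty\}: \text{the light-line of } x \text{ is orthogonal to } S(p)\}$, where $x\in\mathbb{R}^n$ corresponds to the line spanned by $x+v_0+(x,x)v_\infty$ and $\infty$ to $\langle v_\infty\rangle$. A map $f:M\to\mathbb{R}^n$ envelopes $S$ if, with $\phi=f+v_0+(f,f)v_\infty$, one has $S(p)\perp\phi(p)$ and $S(p)\perp d\phi(T_pM)$ for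 all $p$ (the sphere has first order contact with $f$ at $p$). $S$ is full if there is no fixed hyperplane of $\mathbb{R}^{n+1,1}$ containing all the planes $S(p)$, $p\in M$. If $f,\hat f$ both envelope $S$, then $N\mapsto gNg^{-1}$ gives an isomorphism from the normal bundle of $f$ to that of $\hat f$. $S$ is conformal if $f$ and $\hat f$ induce conformally equivalent metrics on $M$. $S$ is Ribaucour if for each normal $N$ to $f$ the shape operators $A^N$ of $f$ and $\hat A^{gNg^{-1}}$ of $\hat f$ commute. A point is umbilic for an immersion if at that point every shape operator is a multiple of the identity. *)

(* Defs.v *)
From HB Require Import structures.
From mathcomp Require Import all_boot all_order all_algebra.
From mathcomp Require Import falgebra ring.
From mathcomp Require Import all_classical all_reals all_analysis.

Set Implicit Arguments.
Unset Strict Implicit.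
Unset Printing Implicit Defensive.

Import Order.TTheory GRing.Theory Num.Theory.
Import numFieldNormedType.Exports.

Local Open Scope classical_set_scope.
Local Open Scope ring_scope.

Section SymmetricDifference.
Variable T : finType.
Implicit Types A B C : {set T}.

Definition symd A B : {set T} := [set x | (x \in A) (+) (x \in B)]%SET.

Lemma in_symd A B x : (x \in symd A B) = (x \in A) (+) (x \in B).
Proof. by rewrite inE. Qed.

Lemma symdK A : involutive (symd A).
Proof. by move=> B; apply/setP => x; rewrite !in_symd addKb. Qed.

Lemma symdC A B : symd A B = symd B A.
Proof. by apply/setP => x; rewrite !in_symd addbC. Qed.

Lemma symdA A B C : symd A (symd B C) = symd (symd A B) C.
Proof. by apply/setP => x; rewrite !in_symd addbA. Qed.

Lemma symd0 A : symd finset.set0 A = A.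
Proof. by apply/setP => x; rewrite in_symd inE. Qed.

Lemma symdv A : symd A A = finset.set0.
Proof. by apply/setP => x; rewrite in_symd inE addbb. Qed.

End SymmetricDifference.

Definition dot (K : fieldType) (n : nat) (v w : 'rV[K]_n) : K :=
  \sum_i v 0 i * w 0 i.

(* An element of the Clifford algebra is the family of its coordinates in the
   basis e_A = e_(i1) ... e_(ik), where i1 < ... < ik enumerate A. *)
Definition clifford (K : fieldType) (n : nat) : Type := {ffun {set 'I_n} -> K^o}.

HB.instance Definition _ (K : fieldType) (n : nat) :=
  Vector.on (clifford K n).

Section Clifford.
Variables (K : fieldType) (n : nat).
Implicit Types (A B C : {set 'I_n}) (u v w : clifford K n).

(* e_A e_B = csign A B e_(A symd B): sorting the concatenated word yields a
   sign for each pair j < i with i in A and j in B (e_i e_j = - e_j e_i), and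
   one for each i in both A and B (e_i e_i = -1). *)
Definition csign A B : K := \prod_(i in A) \prod_(j in B | (j <= i)%N) (-1).

Definition cbasis A : clifford K n := [ffun B => (B == A)%:R].

Definition cmul u v : clifford K n :=
  [ffun C => \sum_A csign A (symd A C) * u A * v (symd A C)].

Let csignE A B : csign A B =
  \prod_i \prod_j (-1) ^+ [&& i \in A, j \in B & (j <= i)%N].
Proof.
rewrite /csign big_mkcond; apply: eq_bigr => i _.
case: (i \in A) => /=; last by rewrite big1.
by rewrite big_mkcond; apply: eq_bigr => j _; case: (_ && _).
Qed.

Let csign_symdl A B C : csign (symd A B) C = csign A C * csign B C.
Proof.
rewrite !csignE -big_split; apply: eq_bigr => i _ /=.
rewrite -big_split; apply: eq_bigr => j _ /=.
by rewrite -signr_addb -andb_addl -in_symd.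
Qed.

Let csign_symdr A B C : csign C (symd A B) = csign C A * csign C B.
Proof.
rewrite !csignE -big_split; apply: eq_bigr => i _ /=.
rewrite -big_split; apply: eq_bigr => j _ /=.
by rewrite -signr_addb -andb_addr -andb_addl -in_symd.
Qed.

Let csign0l A : csign finset.set0 A = 1.
Proof. by rewrite /csign big1 // => i; rewrite inE. Qed.

Let csign0r A : csign A finset.set0 = 1.
Proof.
by rewrite /csign big1 // => i _; rewrite big1 // => j; rewrite inE.
Qed.

Fact cmulA : associative cmul.
Proof.
move=> u v w; apply/ffunP => E; rewrite !ffunE.
under eq_bigr => A _ do rewrite ffunE mulr_sumr.
under [RHS]eq_bigr => C _ do rewrite ffunE mulr_sumr mulr_suml.
rewrite [RHS]exchange_big /=; apply: eq_bigr => A _.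
rewrite (reindex_inj (inv_inj (symdK A))) /=; apply: eq_bigr => C _.
have -> : symd (symd A C) (symd A E) = symd C E.
  by rewrite [symd A C]symdC -symdA symdK.
have hs : csign A (symd A E) * csign (symd A C) (symd C E)
    = csign C (symd C E) * csign A (symd A C).
  rewrite csign_symdl.
  have -> : symd A E = symd (symd A C) (symd C E) by rewrite -symdA symdK.
  rewrite csign_symdr.
  have sq : csign A (symd C E) * csign A (symd C E) = 1.
    by rewrite -csign_symdr symdv csign0r.
  transitivity (csign A (symd A C) * csign C (symd C E)
    * (csign A (symd C E) * csign A (symd C E))); first by ring.
  by rewrite sq; ring.
transitivity (csign A (symd A E) * csign (symd A C) (symd C E)
  * (u A * v (symd A C) * w (symd C E))); first by ring.
by rewrite hs; ring.
Qed.

Fact cmul1l : left_id (cbasis finset.set0) cmul.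
Proof.
move=> u; apply/ffunP => C; rewrite ffunE (bigD1 finset.set0) //= ffunE eqxx.
rewrite symd0 csign0l !mul1r big1 ?addr0 // => A /negbTE A0.
by rewrite ffunE A0 mulr0 mul0r.
Qed.

Fact cmul1r : right_id (cbasis finset.set0) cmul.
Proof.
move=> u; apply/ffunP => C; rewrite ffunE (bigD1 C) //= symdv ffunE eqxx.
rewrite csign0r mul1r mulr1 big1 ?addr0 // => A AC.
rewrite ffunE; case: eqP => [h|]; last by rewrite mulr0.
by case/eqP: AC; rewrite -(symdK A C) h symdC symd0.
Qed.

Fact cmulDl : left_distributive cmul +%R.
Proof.
move=> u v w; apply/ffunP => C; rewrite !ffunE -big_split.
by apply: eq_bigr => A _; rewrite !ffunE mulrDr mulrDl.
Qed.

Fact cmulDr : right_distributive cmul +%R.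
Proof.
move=> u v w; apply/ffunP => C; rewrite !ffunE -big_split.
by apply: eq_bigr => A _; rewrite !ffunE mulrDr.
Qed.

Fact cone_neq0 : cbasis finset.set0 != 0.
Proof.
apply/eqP => /ffunP/(_ finset.set0)/eqP.
by rewrite !ffunE eqxx oner_eq0.
Qed.

HB.instance Definition _ := GRing.Zmodule_isNzRing.Build (clifford K n)
  cmulA cmul1l cmul1r cmulDl cmulDr cone_neq0.

Fact cscaleAl (a : K) u v : a *: (u * v) = (a *: u) * v.
Proof.
apply/ffunP => C; rewrite !ffunE [LHS]mulr_sumr.
apply: eq_bigr => A _; rewrite ffunE mulrA; congr (_ * _).
exact: (mulrCA a (csign A (symd A C)) (u A)).
Qed.

HB.instance Definition _ :=
  GRing.Lmodule_isLalgebra.Build K (clifford K n) cscaleAl.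

Fact cscaleAr (a : K) u v : a *: (u * v) = u * (a *: v).
Proof.
apply/ffunP => C; rewrite !ffunE [LHS]mulr_sumr.
by apply: eq_bigr => A _; rewrite ffunE; exact: (@mulrCA K).
Qed.

HB.instance Definition _ :=
  GRing.Lalgebra_isAlgebra.Build K (clifford K n) cscaleAr.

(* This equips the algebra with the inverse u^-1 of its units. *)
HB.instance Definition _ := Algebra_isFalgebra.Build K (clifford K n).

Definition cvec (v : 'rV[K]_n) : clifford K n :=
  \sum_i v 0 i *: cbasis [set i]%SET.

Lemma cbasisM A B : cbasis A * cbasis B = csign A B *: cbasis (symd A B).
Proof.
apply/ffunP => C; rewrite !ffunE (bigD1 A) //= !ffunE eqxx big1 ?addr0.
  rewrite mulr1 -(inj_eq (inv_inj (symdK A)) (symd A C) B) symdK.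
  have [->|_] := eqVneq C (symd A B); first by rewrite symdK.
  by rewrite mulr0 scaler0.
by move=> D /negbTE DA; rewrite ffunE DA mulr0 mul0r.
Qed.

Lemma cbasis1M (i j : 'I_n) :
  cbasis [set i]%SET * cbasis [set j]%SET
    + cbasis [set j]%SET * cbasis [set i]%SET = - (i == j)%:R *+ 2.
Proof.
have s1 (k l : 'I_n) :
    csign [set k]%SET [set l]%SET = if (l <= k)%N then -1 else 1.
  rewrite /csign finset.big_set1 big_mkcondr /= finset.big_set1.
  by [].
rewrite !cbasisM !s1; have [->|ij] := eqVneq i j.
  by rewrite leqnn symdv -mulr2n scaleN1r.
rewrite [symd [set j]%SET _]symdC oppr0 mul0rn -scalerDl.
have : (i != j :> nat) by [].
by case: ltngtP => // _ _; rewrite ?subrr ?addNr scale0r.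
Qed.

Lemma clifford_relation (v w : 'rV[K]_n) :
  cvec v * cvec w + cvec w * cvec v = (- (dot v w *+ 2))%:A.
Proof.
have e x y : cvec x * cvec y = \sum_i \sum_j (x 0 i * y 0 j) *:
    (cbasis [set i]%SET * cbasis [set j]%SET).
  rewrite mulr_suml; apply: eq_bigr => i _; rewrite mulr_sumr.
  by apply: eq_bigr => j _; rewrite -scalerAl -scalerAr scalerA.
rewrite !e [X in _ + X]exchange_big -big_split /= /dot -sumrMnl -sumrN.
rewrite scaler_suml; apply: eq_bigr => i _.
rewrite -big_split (bigD1 i) //= big1 ?addr0 => [|j ji].
  rewrite [w 0 i * _]mulrC -scalerDr cbasis1M eqxx.
  by rewrite -scalerMnr scalerN mulNrn scaleNr -scalerMnl.
by rewrite [w 0 j * _]mulrC -scalerDr cbasis1M eq_sym (negbTE ji) oppr0 mul0rn scaler0.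
Qed.

End Clifford.

Section Clifford_real.
Variables (R : realFieldType) (n : nat).
Implicit Types v w : 'rV[R]_n.

Lemma dot_eq0 v : (dot v v == 0) = (v == 0).
Proof.
apply/eqP/eqP => [h|->]; last by rewrite /dot big1 // => i _; rewrite mxE mul0r.
apply/rowP => i; rewrite mxE; apply/eqP; rewrite -[_ == 0]sqrf_eq0 expr2.
apply/eqP; have := @psumr_eq0P _ _ xpredT (fun i => v 0 i * v 0 i).
by apply=> // j _; rewrite -expr2 sqr_ge0.
Qed.

Lemma cvecM v : cvec v * cvec v = (- dot v v)%:A.
Proof.
have := clifford_relation v v; rewrite -!mulr2n -mulNrn -scalerMnl.
move=> /eqP; rewrite -subr_eq0 -mulrnBl -scaler_nat scaler_eq0 pnatr_eq0 /=.
by rewrite subr_eq0 => /eqP.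
Qed.

Lemma cvec_unit v : v != 0 -> cvec v \is a GRing.unit.
Proof.
move=> v0; apply/unitrP; exists ((- dot v v)^-1 *: cvec v).
have dv0 : - dot v v != 0 by rewrite oppr_eq0 dot_eq0.
by rewrite -scalerAl -scalerAr cvecM scalerA mulVf // scale1r.
Qed.

Lemma cvec_conj v w : v != 0 -> exists w', cvec w' = cvec v * cvec w * (cvec v)^-1.
Proof.
move=> v0; exists ((dot v w *+ 2 / dot v v) *: v - w).
have lin (a : R) x y : cvec (a *: x - y) = a *: cvec x - cvec y.
  rewrite /cvec scaler_sumr -sumrB; apply: eq_bigr => i _.
  by rewrite !mxE scalerBl scalerA.
apply: (canRL (mulrK (cvec_unit v0))); rewrite lin mulrBl.
rewrite -scalerAl cvecM scalerA mulrN divfK ?dot_eq0 //.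
by rewrite -(clifford_relation v w) addrK.
Qed.

End Clifford_real.

Section Smooth.
Variables (R : realType) (V W : normedModType R).

Fixpoint Ck (k : nat) (U : set V) (f : V -> W) : Prop :=
  if k is k'.+1 then
    (forall x, U x -> differentiable f x) /\
    (forall v, Ck k' U (fun x => 'd f x v))
  else forall x, U x -> {for x, continuous f}.

(* Meant for U open: only the germs of f at the points of U matter. *)
Definition smooth_on (U : set V) (f : V -> W) : Prop := forall k, Ck k U f.

End Smooth.

(* A homeomorphism cmap from the open set cdom onto an open set of R^2, with
   inverse cinv; both maps are total, with junk values off these sets. *)
Record chart (R : realType) (M : topologicalType) := Chart {
  cdom : set M;
  cmap : M -> 'rV[R]_2;
  cinv : 'rV[R]_2 -> M;
  cdom_open : open cdom;
  cimg_open : open (cmap @` cdom);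
  cmapK : forall p, cdom p -> cinv (cmap p) = p;
  cmap_continuous : {within cdom, continuous cmap};
  cinv_continuous : {within cmap @` cdom, continuous cinv}
}.

(* A smooth 2-manifold, given by an atlas which need not be maximal. *)
Record surface (R : realType) := Surface {
  carrier :> topologicalType;
  atlas : set (chart R carrier);
  surface_hausdorff : hausdorff_space carrier;
  surface_second_countable : @second_countable carrier;
  atlas_cover : forall p, exists2 c, atlas c & cdom c p;
  atlas_smooth : forall c d, atlas c -> atlas d ->
    smooth_on (cmap c @` (cdom c `&` cdom d)) (cmap d \o cinv c)
}.

Section MapsOnSurface.
Variables (R : realType) (M : surface R).

Definition chart_at (p : M) (c : chart R M) : Prop := atlas c /\ cdom c p.

Section Differential.
Variable W : normedModType R.
Implicit Types (F : M -> W) (c : chart R M) (p : M).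

Definition smooth_in (U : set M) F : Prop :=
  forall c, atlas c -> smooth_on (cmap c @` (cdom c `&` U)) (F \o cinv c).

Definition smooth F : Prop := smooth_in setT F.

(* A chart c at p identifies T_pM with R^2; the differential dF_p and the
   second derivative D^2F_p(X, Y) = d_X (d_Y F) are written in these
   coordinates. *)
Definition tmap F c p (X : 'rV[R]_2) : W := 'd (F \o cinv c) (cmap c p) X.

Definition tmap2 F c p (X Y : 'rV[R]_2) : W :=
  'd (fun x => 'd (F \o cinv c) x Y) (cmap c p) X.

Definition immersion F : Prop :=
  smooth F /\ forall p c, chart_at p c -> injective (tmap F c p).

End Differential.

Section ShapeOperator.
Variable n : nat.
Implicit Types (f : M -> 'rV[R]_n) (c : chart R M) (p : M) (N : 'rV[R]_n).

Definition normal f p N : Prop :=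
  forall c, chart_at p c -> forall X, dot N (tmap f c p X) = 0.

Definition induced_metric f c p (X Y : 'rV[R]_2) : R :=
  dot (tmap f c p X) (tmap f c p Y).

(* The component along N of the second fundamental form, which is the normal
   part of D^2f; as N is normal, the tangential part of D^2f drops out. *)
Definition second_form f c p N (X Y : 'rV[R]_2) : R := dot (tmap2 f c p X Y) N.

Definition form_mx (b : 'rV[R]_2 -> 'rV[R]_2 -> R) : 'M[R]_2 :=
  \matrix_(i, j) b (delta_mx 0 i) (delta_mx 0 j).

(* The matrix of the shape operator A^N, acting on row vectors by
   A^N X = X *m shape_op f c p N. It is determined by
   (df (A^N X), df Y) = (D^2f (X, Y), N), see shape_opP. *)
Definition shape_op f c p N : 'M[R]_2 :=
  form_mx (second_form f c p N) *m invmx (form_mx (induced_metric f c p)).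

Definition umbilic f p : Prop :=
  forall c N, chart_at p c -> normal f p N -> is_scalar_mx (shape_op f c p N).

Let dotZl a (v w : 'rV[R]_n) : dot (a *: v) w = a * dot v w.
Proof. by rewrite /dot mulr_sumr; apply: eq_bigr => i _; rewrite mxE mulrA. Qed.

Let dot_suml (F : 'I_2 -> 'rV[R]_n) w : dot (\sum_i F i) w = \sum_i dot (F i) w.
Proof.
rewrite /dot exchange_big; apply: eq_bigr => j _.
by rewrite summxE mulr_suml.
Qed.

Lemma induced_metric_delta f c p (X : 'rV[R]_2) j :
  (X *m form_mx (induced_metric f c p)) 0 j
  = induced_metric f c p X (delta_mx 0 j).
Proof.
rewrite mxE [X in RHS](row_sum_delta X) /induced_metric /tmap linear_sum /=.
rewrite dot_suml.
by apply: eq_bigr => i _; rewrite mxE linearZ dotZl.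
Qed.

Lemma metric_unit f c p :
  immersion f -> chart_at p c -> form_mx (induced_metric f c p) \in unitmx.
Proof.
move=> [_ f_inj] /f_inj inj; rewrite -row_free_unit -kermx_eq0.
apply/rowV0P => X /sub_kermxP X0; apply: inj.
have: induced_metric f c p X X = 0; last first.
  by move=> /eqP; rewrite dot_eq0 => /eqP ->; rewrite /tmap linear0.
have dotC (u v : 'rV[R]_n) : dot u v = dot v u.
  by apply: eq_bigr => i _; rewrite mulrC.
rewrite /induced_metric dotC {1}(row_sum_delta X) /tmap linear_sum /=.
rewrite dot_suml big1 // => i _; rewrite linearZ dotZl dotC.
by rewrite -[dot _ _](induced_metric_delta f c p X i) X0 mxE mulr0.
Qed.

Lemma shape_opP f c p N i j : immersion f -> chart_at p c ->
  induced_metric f c p (delta_mx 0 i *m shape_op f c p N) (delta_mx 0 j)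
  = second_form f c p N (delta_mx 0 i) (delta_mx 0 j).
Proof.
move=> fi cp; rewrite -induced_metric_delta -mulmxA mulmxKV ?metric_unit //.
by rewrite -rowE !mxE.
Qed.

End ShapeOperator.

Definition conformally_equivalent n (f f' : M -> 'rV[R]_n) : Prop :=
  exists lambda : M -> R,
    [/\ smooth lambda, forall p, 0 < lambda p &
        forall p c X Y, chart_at p c ->
          induced_metric f' c p X Y = lambda p * induced_metric f c p X Y].

End MapsOnSurface.

Definition wedge (T : Type) (A : pzRingType) (a b : T -> A) (X Y : T) : A :=
  a X * b Y - a Y * b X.

(* R^(n+1,1): the last two coordinates are those along v0 and voo. *)
Notation lorentz R n := 'rV[R]_(n + (1 + 1)).

Section Lorentz.
Variables (R : realType) (n : nat).

Definition euclid_part (v : lorentz R n) : 'rV[R]_n := lsubmx v.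
Definition v0_coord (v : lorentz R n) : R := lsubmx (rsubmx v) 0 0.
Definition voo_coord (v : lorentz R n) : R := rsubmx (rsubmx v) 0 0.

Definition ldot (v w : lorentz R n) : R :=
  dot (euclid_part v) (euclid_part w)
  - 2^-1 * (v0_coord v * voo_coord w + voo_coord v * v0_coord w).

Definition v0 : lorentz R n := row_mx 0 (row_mx 1 0).
Definition voo : lorentz R n := row_mx 0 (row_mx 0 1).
Definition euclid (x : 'rV[R]_n) : lorentz R n := row_mx x 0.

Definition lightlike (x : 'rV[R]_n) : lorentz R n :=
  euclid x + v0 + dot x x *: voo.

End Lorentz.

Section SphereCongruence.
Variables (R : realType) (M : surface R) (n : nat).
Implicit Types (S : M -> {vspace lorentz R n}) (f : M -> 'rV[R]_n).

(* A smooth map into the Grassmannian of positive (n-2)-planes, smoothness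
   being the existence of smooth local frames. *)
Definition sphere_congruence S : Prop :=
  [/\ forall p, \dim (S p) = (n - 2)%N,
      forall p v, v \in S p -> v != 0 -> 0 < ldot v v &
      forall p, exists (U : set M) (s : 'I_(n - 2) -> M -> lorentz R n),
        [/\ open U, U p, forall i, smooth_in U (s i) &
            forall q, U q -> S q = <<[seq s i q | i <- enum 'I_(n - 2)]>>%VS]].

Definition envelopes f S : Prop :=
  forall p v, v \in S p ->
    ldot v (lightlike (f p)) = 0 /\
    forall c X, chart_at p c -> ldot v (tmap (@lightlike R n \o f) c p X) = 0.

Definition full S : Prop :=
  ~ exists H : {vspace lorentz R n},
      \dim H = n.+1 /\ forall p, (S p <= H)%VS.

(* N' is the vector g N g^-1, where g = f' - f. *)
Definition ribaucour f f' : Prop :=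
  forall p c (N N' : 'rV[R]_n), chart_at p c -> normal f p N ->
    cvec N' = cvec (f' p - f p) * cvec N * (cvec (f' p - f p))^-1 ->
    shape_op f c p N *m shape_op f' c p N'
    = shape_op f' c p N' *m shape_op f c p N.

End SphereCongruence.

(* Main.v *)
Require Import Defs.
From HB Require Import structures.
From mathcomp Require Import all_boot all_order all_algebra.
From mathcomp Require Import ring lra zify.
From mathcomp Require Import all_classical all_reals all_analysis.

Set Implicit Arguments.
Unset Strict Implicit.
Unset Printing Implicit Defensive.

Import Order.TTheory GRing.Theory Num.Theory.
Import numFieldNormedType.Exports.

Local Open Scope classical_set_scope.
Local Open Scope ring_scope.

(* Write phi = lightlike f, phi' = lightlike f' and let rho be the reflection
   along g = f' - f. A vector of S(p) amounts to a normal vector N of f at p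
   such that rho N is normal to f', so rho maps the tangent planes of f' to
   those of f: rho df' = df o B for an endomorphism B of T_pM. The equation to
   be proved says that B is symmetric and trace free, that is, since S is
   conformal, that det B < 0.
   Suppose that det B > 0 at some point. If L and L' denote the Hessians of
   (s, phi) and (s, phi') for s in S(p), then L' = B L, and these are the second
   fundamental forms of f and f' up to multiples of the metrics. With S
   Ribaucour, plane algebra shows that either B is a multiple of the identity
   or L = L' = 0 for every s; in the latter case p is umbilic for both f and
   f'. So B = mu id wherever det B > 0. There d phi' = mu d phi + th (phi' - phi)
   for a 1-form th, and differentiating once more gives d mu = (mu - 1) th, so
   that w = phi' - mu phi satisfies d w = th w: the line spanned by w is locally
   constant. As M is connected, it is constant on M, and its orthogonal
   hyperplane contains all the S(p), which contradicts fullness. *)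

(** * Conformal endomorphisms of a plane *)

Section PlaneAlgebra.
Variables (K : realFieldType) (E F H l b11 b12 b21 b22 : K).
Hypothesis E_gt0 : 0 < E.
Hypothesis G_gt0 : 0 < E * H - F ^+ 2.
Hypothesis l_gt0 : 0 < l.
Hypothesis conf11 : b11 * (b11 * E + b12 * F) + b12 * (b11 * F + b12 * H) = l * E.
Hypothesis conf12 : b11 * (b21 * E + b22 * F) + b12 * (b21 * F + b22 * H) = l * F.
Hypothesis conf22 : b21 * (b21 * E + b22 * F) + b22 * (b21 * F + b22 * H) = l * H.

Local Notation det := (b11 * b22 - b12 * b21).

(** With G = [[E, F], [F, H]] the three hypotheses are the entries of B G B^T = l G; taking
    determinants gives det^2 = l^2. *)
Lemma conformal_det : det = l \/ det = - l.
Proof.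
have h : (det - l) * (det + l) * (E * H - F ^+ 2) = 0.
  transitivity (det ^+ 2 * (E * H - F ^+ 2) - (l * E * (l * H) - (l * F) ^+ 2)).
    by ring.
  by rewrite -conf11 -conf12 -conf22; ring.
have /eqP := h; rewrite mulf_eq0 (gt_eqF G_gt0) orbF mulf_eq0.
by case/orP => /eqP e; [left|right]; lra.
Qed.

(** Multiplying B G B^T = l G on the right by adj(B^T) turns it into det (B G) = l G adj(B^T). For
    det = - l, two entries of this equation give the vanishing trace and the symmetry of B G. *)
Lemma anticonformal : det < 0 ->
  b11 + b22 = 0 /\ b11 * F + b12 * H = b21 * E + b22 * F.
Proof.
move=> det_lt0; have dl : det = - l by case: conformal_det => // e;
  rewrite e ltNge ltW in det_lt0.
have tr0 : l * (E * (b11 + b22)) = 0.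
  have : b22 * (l * E) - b12 * (l * F) = det * (b11 * E + b12 * F).
    by rewrite -conf11 -conf12; ring.
  by rewrite dl => e; lra.
have {}tr0 : b11 + b22 = 0.
  by move/eqP: tr0; rewrite !mulf_eq0 (gt_eqF l_gt0) (gt_eqF E_gt0) => /eqP.
split=> //.
have : b22 * (l * F) - b12 * (l * H) = det * (b21 * E + b22 * F).
  by rewrite -conf12 -conf22; ring.
rewrite dl => e; have : l * (b22 * F - b12 * H + b21 * E + b22 * F) = 0 by lra.
move/eqP; rewrite mulf_eq0 (gt_eqF l_gt0) /= => /eqP e2.
have -> : b11 = - b22 by lra.
by lra.
Qed.

(** The form [[a, b], [b, c]] has trace zero with respect to G and determinant zero. Completing the
    square in the trace condition leaves a vanishing sum of two nonnegative terms. *)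
Lemma tracefree_eq0 a b c : H * a - 2 * F * b + E * c = 0 -> a * c = b ^+ 2 ->
  [/\ a = 0, b = 0 & c = 0].
Proof.
move=> tr0 det0.
have q : (E * b - F * a) ^+ 2 + (E * H - F ^+ 2) * a ^+ 2 = 0.
  transitivity (E * (a * (H * a - 2 * F * b + E * c)) + E ^+ 2 * (b ^+ 2 - a * c)).
    by ring.
  by rewrite tr0 det0; ring.
have a0 : a = 0.
  apply/eqP; rewrite -sqrf_eq0; apply/eqP.
  have /eqP : (E * H - F ^+ 2) * a ^+ 2 = 0.
    by have := sqr_ge0 (E * b - F * a); have := mulr_ge0 (ltW G_gt0) (sqr_ge0 a); lra.
  by rewrite mulf_eq0 (gt_eqF G_gt0) => /eqP.
have b0 : b = 0 by apply/eqP; rewrite -sqrf_eq0 -det0 a0 mul0r.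
split=> //; move/eqP: tr0; rewrite a0 b0 !mulr0 subrr add0r mulf_eq0 (gt_eqF E_gt0).
by move/eqP.
Qed.

(* Entrywise, B = m + k J adj(G) with J = [[0, 1], [-1, 0]]. *)
Lemma conformal_rotation : 0 < det ->
  exists k, [/\ b12 = k * E, b21 = - (k * H) & b22 = b11 + 2 * k * F].
Proof.
move=> det_gt0; have dl : det = l by case: conformal_det => // e;
  rewrite e oppr_gt0 ltNge ltW in det_gt0.
exists (b12 / E).
have e12 : b12 = b12 / E * E by rewrite divfK // gt_eqF.
(* [h1] and [h2] are the entries (1, 1) and (2, 1) of det (B G) = l G adj(B^T), now with det = l. *)
have h1 : l * (b22 * E - b12 * F) = l * (b11 * E + b12 * F).
  transitivity (b22 * (l * E) - b12 * (l * F)); first by ring.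
  by rewrite -conf11 -conf12 -[in RHS]dl; ring.
have h2 : l * (b22 * F - b12 * H) = l * (b21 * E + b22 * F).
  transitivity (b22 * (l * F) - b12 * (l * H)); first by ring.
  by rewrite -conf12 -conf22 -[in RHS]dl; ring.
have l0 : l != 0 by rewrite gt_eqF.
have E0 : E != 0 by rewrite gt_eqF.
move/(mulfI l0) : h1 => h1; move/(mulfI l0) : h2 => h2.
split=> //; apply: (mulfI E0); set k := _ / _ in e12 *; rewrite e12 in h1 h2; lra.
Qed.

(* With L = [[a, b], [b, c]], these are p = L adj(G) and q = B p; of their
   commutation only the entry (1, 2) is needed. *)
Lemma ribaucour_dichotomy a b c : 0 < det ->
  b11 * b + b12 * c = b21 * a + b22 * b ->
  let p11 := a * H - b * F in let p12 := b * E - a * F in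
  let p21 := b * H - c * F in let p22 := c * E - b * F in
  let q11 := b11 * p11 + b12 * p21 in let q12 := b11 * p12 + b12 * p22 in
  let q22 := b21 * p12 + b22 * p22 in
  p11 * q12 + p12 * q22 = q11 * p12 + q12 * p22 ->
  [/\ b12 = 0, b21 = 0 & b11 = b22] \/ [/\ a = 0, b = 0 & c = 0].
Proof.
move=> /conformal_rotation [k [e12 e21 e22]] sym /= /eqP; rewrite -subr_eq0 => c12.
have [k0|k_neq0] := eqVneq k 0.
  by left; rewrite e12 e21 e22 k0; split; ring.
right.
(* For B in the form just found, the symmetry of B L says that k times the trace of L with respect
   to G is zero. *)
have tr0 : H * a - 2 * F * b + E * c = 0.
  have : k * (H * a - 2 * F * b + E * c) = 0 by rewrite e12 e21 e22 in sym; lra.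
  by move/eqP; rewrite mulf_eq0 (negbTE k_neq0) => /eqP.
apply: tracefree_eq0 => //; apply/eqP; rewrite -subr_eq0.
have E0 : E != 0 by rewrite gt_eqF.
have ce : c = (2 * F * b - H * a) / E by apply: (canRL (mulfK E0)); lra.
(* Modulo the trace condition, the commutator entry is a product whose only factor that can vanish
   is a c - b^2. *)
move: c12; rewrite [X in X == 0](_ : _ =
    2 * k * (a * c - b ^+ 2) * (E * H - F ^+ 2) * E).
  by rewrite !mulf_eq0 pnatr_eq0 (negbTE k_neq0) (negbTE E0) (gt_eqF G_gt0) !orbF.
by rewrite e12 e21 e22 ce; field.
Qed.
End PlaneAlgebra.

(** * The scalar product and directional derivatives *)

Section Dot.
Variables (K : fieldType) (n : nat).
Implicit Types u v w : 'rV[K]_n.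

Lemma dotC u v : dot u v = dot v u.
Proof. by apply: eq_bigr => i _; rewrite mulrC. Qed.

Lemma dotDl u v w : dot (u + v) w = dot u w + dot v w.
Proof. by rewrite -big_split; apply: eq_bigr => i _; rewrite mxE mulrDl. Qed.

Lemma dotZl a u w : dot (a *: u) w = a * dot u w.
Proof. by rewrite mulr_sumr; apply: eq_bigr => i _; rewrite mxE mulrA. Qed.

Lemma dotNl u w : dot (- u) w = - dot u w.
Proof. by rewrite -scaleN1r dotZl mulN1r. Qed.

Lemma dotBl u v w : dot (u - v) w = dot u w - dot v w.
Proof. by rewrite dotDl dotNl. Qed.

Lemma dotDr u v w : dot w (u + v) = dot w u + dot w v.
Proof. by rewrite dotC dotDl !(dotC w). Qed.

Lemma dotZr a u w : dot w (a *: u) = a * dot w u.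
Proof. by rewrite dotC dotZl (dotC w). Qed.

Lemma dotNr u w : dot w (- u) = - dot w u.
Proof. by rewrite dotC dotNl (dotC w). Qed.

Lemma dotBr u v w : dot w (u - v) = dot w u - dot w v.
Proof. by rewrite dotDr dotNr. Qed.

Lemma dot0l w : dot 0 w = 0.
Proof. by rewrite /dot big1 // => i _; rewrite mxE mul0r. Qed.

Definition dotE := (dotDl, dotBl, dotNl, dotZl, dotDr, dotBr, dotNr, dotZr).

End Dot.

Lemma dot_gt0 (K : realFieldType) n (v : 'rV[K]_n) : (0 < dot v v) = (v != 0).
Proof.
rewrite lt_neqAle eq_sym dot_eq0 sumr_ge0 ?andbT // => i _.
by rewrite -expr2 sqr_ge0.
Qed.

(** * Directional derivatives, mean values and the symmetry of second derivatives *)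

Section Derivatives.
Variables (R : realType) (V : normedModType R).

Lemma diff_is_derive (W : normedModType R) (F : V -> W) x v :
  differentiable F x -> is_derive x v F ('d F x v).
Proof. by move=> dF; rewrite -deriveE //; apply/derivableP/diff_derivable. Qed.

Lemma is_derive_coord m n (F : V -> 'M[R]_(m, n)) x v dF i j :
  is_derive x v F dF -> is_derive x v (fun y => F y i j) (dF i j).
Proof.
move=> [Fv <-]; rewrite derive_mx // mxE.
by apply: derivableP; move/derivable_mxP: Fv.
Qed.

Lemma is_derive_dot n (F G : V -> 'rV[R]_n) x v dF dG :
  is_derive x v F dF -> is_derive x v G dG ->
  is_derive x v (fun y => dot (F y) (G y)) (dot dF (G x) + dot (F x) dG).
Proof.
move=> hF hG; rewrite [X in is_derive _ _ X _](_ : _ =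
    \sum_(i < n) ((fun y => F y 0 i) * (fun y => G y 0 i))); last first.
  by apply/funext => y; rewrite fct_sumE.
have h i : is_derive x v ((fun y => F y 0 i) * (fun y => G y 0 i))
    (F x 0 i * dG 0 i + G x 0 i * dF 0 i).
  by have hFi := is_derive_coord 0 i hF; have hGi := is_derive_coord 0 i hG;
    apply: is_deriveM.
rewrite (_ : dot _ _ + _ = \sum_i (F x 0 i * dG 0 i + G x 0 i * dF 0 i)).
  exact: is_derive_sum.
rewrite /dot -big_split; apply: eq_bigr => i _ /=.
by rewrite addrC [G x 0 i * _]mulrC.
Qed.

Lemma differentiable_dot n (F G : V -> 'rV[R]_n) x :
  differentiable F x -> differentiable G x ->
  differentiable (fun y => dot (F y) (G y)) x.
Proof.
move=> hF hG; rewrite [X in differentiable X _](_ : _ =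
    \sum_(i < n) ((fun y => F y 0 i) * (fun y => G y 0 i))); last first.
  by apply/funext => y; rewrite fct_sumE.
apply: differentiable_sum => i; apply: differentiableM.
  by apply: (@differentiable_comp _ _ _ _ F (fun N : 'rV_n => N 0 i)) => //;
    exact: differentiable_coord.
by apply: (@differentiable_comp _ _ _ _ G (fun N : 'rV_n => N 0 i)) => //;
  exact: differentiable_coord.
Qed.

Lemma is_derive_line (f : V -> R) (p v : V) (df : R) t :
  is_derive (t *: v + p) v f df -> is_derive t 1 (fun s => f (s *: v + p)) df.
Proof.
have e : (fun h => h^-1 *: (((fun s => f (s *: v + p)) \o shift t) (h *: 1) -
      f (t *: v + p)))
    = (fun h => h^-1 *: ((f \o shift (t *: v + p)) (h *: v) - f (t *: v + p))).
  by apply/funext => h /=; rewrite [_ *: 1]mulr1 scalerDl addrA.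
move=> [dfv <-]; split; rewrite /derivable /derive e //.
Qed.

Lemma MVT_line (f df : V -> R) (p v : V) (t : R) : 0 < t ->
  (forall s : R, 0 <= s <= t -> is_derive (s *: v + p) v f (df (s *: v + p))) ->
  exists2 s : R, 0 <= s <= t & f (t *: v + p) - f p = df (s *: v + p) * t.
Proof.
move=> t_gt0 hf; have hl s : 0 <= s <= t ->
    is_derive s 1 (fun s => f (s *: v + p)) (df (s *: v + p)).
  by move=> st; apply: is_derive_line; exact: hf.
have [|s|| s st e] := @MVT_segment R (fun s => f (s *: v + p))
    (fun s => df (s *: v + p)) 0 t.
- exact: ltW.
- by rewrite in_itv /= => /andP[s0 st]; apply: hl; rewrite (ltW s0) (ltW st).
- apply: derivable_within_continuous => s; rewrite in_itv /= => st.
  by have [] := hl s st.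
by exists s; [rewrite in_itv in st|rewrite scale0r add0r subr0 in e].
Qed.

(** The mean value theorem is used twice: along X for x |-> f (x + t Y) - f x, then along Y for
    [fX]. *)
Lemma second_difference (f fX fXY : V -> R) (p X Y : V) (t : R) : 0 < t ->
  (forall a b : R, 0 <= a <= t -> 0 <= b <= t ->
    is_derive (a *: X + b *: Y + p) X f (fX (a *: X + b *: Y + p))) ->
  (forall a b : R, 0 <= a <= t -> 0 <= b <= t ->
    is_derive (a *: X + b *: Y + p) Y fX (fXY (a *: X + b *: Y + p))) ->
  exists a b : R, [/\ 0 <= a <= t, 0 <= b <= t &
    f (t *: X + t *: Y + p) - f (t *: X + p) - f (t *: Y + p) + f p
      = fXY (a *: X + b *: Y + p) * t * t].
Proof.
move=> t_gt0 hX hXY.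
have tt : 0 <= t <= t by apply/andP; split=> //; exact: ltW.
have t0 : 0 <= (0 : R) <= t by apply/andP; split=> //; exact: ltW.
pose g (x : V) := f (x + t *: Y) - f x.
have [a at_ ea] : exists2 a, 0 <= a <= t &
    g (t *: X + p) - g p = (fX (a *: X + p + t *: Y) - fX (a *: X + p)) * t.
  apply: (@MVT_line g (fun x => fX (x + t *: Y) - fX x)) => // s st.
  have h1 : is_derive (s *: X + p) X (fun x => f (x + t *: Y))
      (fX (s *: X + p + t *: Y)).
    have := hX s t st tt; rewrite addrAC => -[dir_diff dir_diff2].
    have e : (fun h => h^-1 *: (((fun x => f (x + t *: Y)) \o shift (s *: X + p)) (h *: X) -
        f (s *: X + p + t *: Y))) =
        (fun h => h^-1 *: ((f \o shift (s *: X + p + t *: Y)) (h *: X)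
          - f (s *: X + p + t *: Y))).
      by apply/funext => h /=; rewrite !addrA.
    by split; rewrite /derivable /derive e.
  have := hX s 0 st t0; rewrite scale0r addr0 => h2.
  exact: is_deriveB.
have [b bt eb] : exists2 b, 0 <= b <= t &
    fX (t *: Y + (a *: X + p)) - fX (a *: X + p) = fXY (b *: Y + (a *: X + p)) * t.
  apply: MVT_line => // s st.
  by have := hXY a s at_ st; rewrite addrAC addrC.
exists a, b; split=> //.
transitivity (g (t *: X + p) - g p).
  rewrite /g [t *: X + t *: Y + p]addrAC [t *: Y + p]addrC opprB.
  by rewrite [RHS]addrA [RHS]addrAC.
rewrite ea [a *: X + p + _]addrC eb; congr (fXY _ * _ * _).
by rewrite addrA [_ + a *: X]addrC.
Qed.

Lemma near_corner (p X Y : V) (P : V -> Prop) : (\near p, P p) ->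
  exists2 t : R, 0 < t &
    forall a b : R, 0 <= a <= t -> 0 <= b <= t -> P (a *: X + b *: Y + p).
Proof.
(* The summand 1 keeps [m] positive even when X = Y = 0. *)
move=> /nbhs_normP[r /= r0 rP]; pose m := `|X| + `|Y| + 1.
have m0 : 0 < m by rewrite ltr_wpDl // addr_ge0.
exists (r / m); first by rewrite divr_gt0.
move=> a b /andP[a0 a_le] /andP[b0 b_le]; apply: rP => /=.
rewrite /ball_ /= opprD addrCA subrr addr0 normrN.
apply: le_lt_trans (ler_normD _ _) _; rewrite !normrZ !ger0_norm //.
apply: (@le_lt_trans _ _ (r / m * (`|X| + `|Y|))).
  by rewrite mulrDr lerD // ler_wpM2r.
rewrite -mulrA gtr_pMr // mulrC ltr_pdivrMr // mul1r /m ltrDl //.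
Qed.

(** The second difference is symmetric in X and Y, so every small parallelogram at p contains a
    value of [fXY] equal to a value of [fYX]; continuity at p then identifies the two limits. *)
Lemma schwarz (f fX fY fXY fYX : V -> R) (p X Y : V) :
  (\near p, is_derive p X f (fX p)) -> (\near p, is_derive p Y f (fY p)) ->
  (\near p, is_derive p Y fX (fXY p)) -> (\near p, is_derive p X fY (fYX p)) ->
  {for p, continuous fXY} -> {for p, continuous fYX} -> fXY p = fYX p.
Proof.
move=> hX hY hXY hYX cXY cYX; apply/eqP; rewrite -subr_eq0 -normr_le0.
apply/ler_addgt0Pr => e e0; rewrite add0r.
have e20 : 0 < e / 2 by rewrite divr_gt0.
have cXY' : \forall q \near p, `|fXY p - fXY q| < e / 2.
    by have /cvgrPdist_lt/(_ _ e20) := cXY.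
have cYX' : \forall q \near p, `|fYX p - fYX q| < e / 2.
  by have /cvgrPdist_lt/(_ _ e20) := cYX.
have [t t0 ht] := near_corner X Y
  (filterI hX (filterI hY (filterI hXY (filterI hYX (filterI cXY' cYX'))))).
have [a [b [at_ bt eXY]]] : exists a b : R, [/\ 0 <= a <= t, 0 <= b <= t &
    f (t *: X + t *: Y + p) - f (t *: X + p) - f (t *: Y + p) + f p
      = fXY (a *: X + b *: Y + p) * t * t].
  by apply: (second_difference (fX := fX)) => // a b at_ bt; have [? [? [? []]]] := ht a b at_ bt.
have [b' [a' [bt' at' eYX]]] : exists b a : R, [/\ 0 <= b <= t, 0 <= a <= t &
    f (t *: Y + t *: X + p) - f (t *: Y + p) - f (t *: X + p) + f p
      = fYX (b *: Y + a *: X + p) * t * t].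
  by apply: (second_difference (fX := fY)) => // b' a' bt' at';
    rewrite [b' *: Y + _]addrC; have [? [? [? []]]] := ht a' b' at' bt'.
have [_ [_ [_ [_ [hXY' _]]]]] := ht a b at_ bt.
have [_ [_ [_ [_ [_ hYX']]]]] := ht a' b' at' bt'.
have e1 : fXY (a *: X + b *: Y + p) = fYX (a' *: X + b' *: Y + p).
  apply: (mulIf (lt0r_neq0 t0)); apply: (mulIf (lt0r_neq0 t0)).
  by rewrite -eXY [a' *: X + _]addrC -eYX [t *: Y + t *: X]addrC [X in X + f p]addrAC.
rewrite -(subrKA (fXY (a *: X + b *: Y + p))) {2}e1.
apply: le_trans (ler_normD _ _) _; rewrite [e]splitr lerD // ltW //.
by rewrite distrC.
Qed.

Lemma is_derive0_ball (f : V -> R) (p : V) (r : R) :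
  (forall x v, ball p r x -> is_derive x v f 0) ->
  forall x, ball p r x -> f x = f p.
Proof.
move=> hf x; rewrite -ball_normE /= => px.
have [s /andP[s0 s1] | s _] := @MVT_line f (fun=> 0) p (x - p) 1 ltr01.
  apply: hf; rewrite -ball_normE /= opprD addrCA subrr addr0 normrN normrZ.
  by rewrite ger0_norm // distrC (le_lt_trans _ px) // ler_piMl.
by rewrite scale1r subrK mul0r => /eqP; rewrite subr_eq0 => /eqP.
Qed.

End Derivatives.

(** * Reflections and the Clifford algebra *)

Section CliffordRelations.
Variables (K : fieldType) (A : algType K).
Implicit Types a b : A.

(** Only the relations between a and b enter, so the computation takes place in any algebra. The
    coefficient of a b is the determinant of the two combinations. *)
Lemma comb_relation a b (x y z p q r s : K) :
  a * a = (- x)%:A -> b * b = (- y)%:A -> a * b + b * a = (- (2 * z))%:A ->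
  (p *: a + q *: b) * (r *: a + s *: b) =
  (- (p * r * x + q * s * y + 2 * q * r * z))%:A + (p * s - q * r) *: (a * b).
Proof.
move=> aa bb ab; have {}ab : b * a = (- (2 * z))%:A - a * b by rewrite -ab addrAC subrr add0r.
rewrite mulrDl !mulrDr -!scalerAl -!scalerAr !scalerA aa bb ab.
rewrite scalerBr !scalerA scalerBl.
have -> : (- (p * r * x + q * s * y + 2 * q * r * z))%:A =
    (p * r * - x)%:A + (q * r * - (2 * z))%:A + (q * s * - y)%:A :> A.
  by rewrite -!scalerDl; congr (_ *: _); ring.
by rewrite -!addrA; congr (_ + _); rewrite addrCA; congr (_ + _); rewrite addrA addrC.
Qed.

(** The relations give a a a = - x a and a b a = x b - 2 z a. *)
Lemma sandwich_relation a b (x z : K) : x != 0 ->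
  a * a = (- x)%:A -> a * b + b * a = (- (2 * z))%:A ->
  a * (x^-1 *: (b - (2 * z / x) *: a)) * a = b.
Proof.
move=> x0 aa ab.
have aaa : a * a * a = - x *: a by rewrite aa -scalerAl mul1r.
have aba : a * b * a = x *: b - (2 * z) *: a.
  rewrite (_ : a * b = (- (2 * z))%:A - b * a); last by rewrite -ab addrK.
  by rewrite mulrBl -mulrA aa -scalerAl -scalerAr mul1r mulr1 !scaleNr opprK addrC.
rewrite -scalerAr -scalerAl mulrBr mulrBl -scalerAr -scalerAl aaa aba !scalerA.
rewrite mulrN divfK // scaleNr opprK subrK scalerA mulVf ?scale1r //.
Qed.

End CliffordRelations.

Section Reflection.
Variables (R : realFieldType) (n : nat).
Implicit Types g u v w : 'rV[R]_n.

Definition refl g v : 'rV[R]_n := v - (2 * dot g v / dot g g) *: g.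

Lemma refl_dot g u v : dot (refl g u) v = dot u (refl g v).
Proof. by rewrite /refl !dotE [dot g v]dotC [dot u g]dotC; ring. Qed.

Lemma reflK g : g != 0 -> involutive (refl g).
Proof.
move=> g0 v; rewrite /refl !dotE mulrBr divfK ?dot_eq0 //.
rewrite -addrA -opprD -scalerDl; set c := (X in X *: _).
have -> : c = 0 by rewrite /c; field; rewrite dot_eq0.
by rewrite scale0r subr0.
Qed.

Lemma refl_isometry g u v : g != 0 -> dot (refl g u) (refl g v) = dot u v.
Proof. by move=> g0; rewrite refl_dot reflK. Qed.

Lemma reflD g u v : refl g (u + v) = refl g u + refl g v.
Proof.
rewrite /refl dotDr mulrDr mulrDl scalerDl opprD addrACA //.
Qed.

Lemma reflZ g a v : refl g (a *: v) = a *: refl g v.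
Proof.
by rewrite /refl dotZr scalerBr scalerA; congr (_ - _ *: _); ring.
Qed.

Lemma cvecZ a v : cvec (a *: v) = a *: cvec v.
Proof.
rewrite /cvec scaler_sumr; apply: eq_bigr => i _.
by rewrite mxE scalerA.
Qed.

Lemma cvecD u v : cvec (u + v) = cvec u + cvec v.
Proof.
rewrite /cvec -big_split; apply: eq_bigr => i _.
by rewrite mxE scalerDl.
Qed.

(** This translates g^-1 df' g^-1 into the reflected differential rho df', up to the factor 1 / (g,
    g). *)
Lemma cvec_sandwich g v : g != 0 ->
  (cvec g)^-1 * cvec v * (cvec g)^-1 = (dot g g)^-1 *: cvec (refl g v).
Proof.
move=> g0; have gU := cvec_unit g0.
apply: (canLR (mulrK gU)); apply: (canLR (mulKr gU)).
rewrite /refl cvecD -scaleNr cvecZ scaleNr; apply/esym.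
rewrite mulrA; apply: sandwich_relation; [by rewrite dot_eq0|exact: cvecM|].
by rewrite mulr_natl; exact: clifford_relation.
Qed.

Lemma cvec_comb_mul u v p q r s :
  cvec (p *: u + q *: v) * cvec (r *: u + s *: v) =
  (- (p * r * dot u u + q * s * dot v v + 2 * q * r * dot u v))%:A
    + (p * s - q * r) *: (cvec u * cvec v).
Proof.
rewrite !cvecD !cvecZ; apply: comb_relation; [exact: cvecM|exact: cvecM|].
by rewrite mulr_natl; exact: clifford_relation.
Qed.

(** Both products are expanded by [cvec_comb_mul]. The trace condition makes the coefficients of u v
    agree; together with the symmetry of B G it makes the scalar parts agree. *)
Lemma cvec_tracefree_comm u v b11 b12 b21 b22 x1 x2 y1 y2 : b11 + b22 = 0 ->
  b11 * dot u v + b12 * dot v v = b21 * dot u u + b22 * dot u v ->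
  let b x1 x2 := (x1 * b11 + x2 * b21) *: u + (x1 * b12 + x2 * b22) *: v in
  cvec (x1 *: u + x2 *: v) * cvec (b y1 y2) =
  cvec (y1 *: u + y2 *: v) * cvec (b x1 x2).
Proof.
move=> tr0 sym /=; have e22 : b22 = - b11 by lra.
rewrite !cvec_comb_mul; congr (_%:A + _ *: _); rewrite e22; last by ring.
rewrite e22 in sym; apply/eqP; rewrite -subr_eq0; apply/eqP.
transitivity ((x1 * y2 - x2 * y1) *
 (b11 * dot u v + b12 * dot v v - (b21 * dot u u + - b11 * dot u v))).
  by ring.
by rewrite sym subrr mulr0.
Qed.

End Reflection.

(** * Tangent planes and spheres *)

Section TangentPlane.
Variables (R : realFieldType) (n : nat) (e1 e2 : 'rV[R]_n).
Local Notation E := (dot e1 e1).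
Local Notation F := (dot e1 e2).
Local Notation H := (dot e2 e2).

Lemma gram_gt0 : (forall a b, a *: e1 + b *: e2 = 0 -> a = 0 /\ b = 0) ->
  [/\ 0 < E, 0 < H & 0 < E * H - F ^+ 2].
Proof.
move=> free_e.
have E0 : 0 < E.
  rewrite dot_gt0; apply/eqP => e10.
  have [] := free_e 1 0; first by rewrite e10 scaler0 scale0r addr0.
  by move/eqP; rewrite oner_eq0.
have H0 : 0 < H.
  rewrite dot_gt0; apply/eqP => e20.
  have [] := free_e 0 1; first by rewrite e20 scaler0 scale0r addr0.
  by move=> _ /eqP; rewrite oner_eq0.
(* [v] is E times the component of [e2] orthogonal to [e1], so its square norm is E (E H - F^2). *)
split=> //; pose v := E *: e2 - F *: e1.
have v0 : v != 0.
  apply/eqP => v0; have [|_ /eqP] := free_e (- F) E.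
    by rewrite scaleNr addrC.
  by rewrite gt_eqF.
have: 0 < E * (E * H - F ^+ 2).
  rewrite (_ : _ * _ = dot v v) ?dot_gt0 // /v !dotE [dot e2 e1]dotC; ring.
by rewrite pmulr_rgt0.
Qed.

(** The coefficients are those of the orthogonal projection. The remainder N is normal, hence
    orthogonal to v by hypothesis, and so to itself. *)
Lemma tangent_coords v : E * H - F ^+ 2 != 0 ->
  (forall N, dot N e1 = 0 -> dot N e2 = 0 -> dot N v = 0) ->
  v = ((dot v e1 * H - dot v e2 * F) / (E * H - F ^+ 2)) *: e1
    + ((dot v e2 * E - dot v e1 * F) / (E * H - F ^+ 2)) *: e2.
Proof.
move=> D0 hN; set a := _ / _; set b := _ / _.
pose N := v - (a *: e1 + b *: e2).
have N1 : dot N e1 = 0 by rewrite /N !dotE [dot e2 e1]dotC /a /b; field.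
have N2 : dot N e2 = 0 by rewrite /N !dotE /a /b; field.
have NN : dot N N = dot N v - (a * dot N e1 + b * dot N e2).
  by rewrite {2}/N dotBr dotDr !dotZr.
by apply/eqP; rewrite -subr_eq0 -/N -dot_eq0 NN N1 N2 hN // !mulr0 addr0 subr0.
Qed.

End TangentPlane.

(** * Spheres as Lorentzian vectors, and their normal vectors *)

Section LorentzSphere.
Variables (R : realType) (n : nat).
Implicit Types (s t : lorentz R n) (x : 'rV[R]_n).

Lemma euclid_partD s t : euclid_part (s + t) = euclid_part s + euclid_part t.
Proof. by rewrite /euclid_part linearD. Qed.
Lemma euclid_partZ a s : euclid_part (a *: s) = a *: euclid_part s.
Proof. by rewrite /euclid_part linearZ. Qed.
Lemma v0_coordD s t : v0_coord (s + t) = v0_coord s + v0_coord t.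
Proof. by rewrite /v0_coord !linearD mxE. Qed.
Lemma v0_coordZ a s : v0_coord (a *: s) = a * v0_coord s.
Proof. by rewrite /v0_coord !linearZ mxE. Qed.
Lemma voo_coordD s t : voo_coord (s + t) = voo_coord s + voo_coord t.
Proof. by rewrite /voo_coord !linearD mxE. Qed.
Lemma voo_coordZ a s : voo_coord (a *: s) = a * voo_coord s.
Proof. by rewrite /voo_coord !linearZ mxE. Qed.

Lemma ldotDl s s' t : ldot (s + s') t = ldot s t + ldot s' t.
Proof.
by rewrite /ldot euclid_partD v0_coordD voo_coordD dotDl; ring.
Qed.

Lemma ldotZl a s t : ldot (a *: s) t = a * ldot s t.
Proof.
by rewrite /ldot euclid_partZ v0_coordZ voo_coordZ dotZl; ring.
Qed.

Lemma euclid_part_lightlike x : euclid_part (lightlike x) = x.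
Proof.
rewrite /lightlike /v0 /voo /euclid !euclid_partD euclid_partZ /euclid_part.
by rewrite !row_mxKl addr0 scaler0 addr0.
Qed.

Lemma v0_coord_lightlike x : v0_coord (lightlike x) = 1.
Proof.
rewrite /lightlike /v0 /voo /euclid !v0_coordD v0_coordZ /v0_coord.
by rewrite !row_mxKr !row_mxKl linear0 !mxE /= mulr0 addr0 add0r.
Qed.

Lemma voo_coord_lightlike x : voo_coord (lightlike x) = dot x x.
Proof.
rewrite /lightlike /v0 /voo /euclid !voo_coordD voo_coordZ /voo_coord.
by rewrite !row_mxKr linear0 !mxE /= mulr1 !add0r.
Qed.

Lemma ldot_lightlike s x : ldot s (lightlike x) =
  dot (euclid_part s) x - 2^-1 * (v0_coord s * dot x x + voo_coord s).
Proof.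
rewrite /ldot euclid_part_lightlike v0_coord_lightlike voo_coord_lightlike.
by rewrite mulr1.
Qed.

Lemma ldot_lightlike2 x y :
  ldot (lightlike x) (lightlike y) = - 2^-1 * dot (y - x) (y - x).
Proof.
rewrite ldot_lightlike euclid_part_lightlike v0_coord_lightlike voo_coord_lightlike.
by rewrite !dotE [dot y x]dotC; field.
Qed.

Lemma euclid_part_euclid x : euclid_part (euclid x) = x.
Proof. exact: row_mxKl. Qed.

Lemma v0_coord_euclid x : v0_coord (euclid x) = 0.
Proof. by rewrite /v0_coord row_mxKr linear0 mxE. Qed.

(* The normal vector at x of the sphere represented by s, when x lies on it. *)
Definition sphere_normal x s := euclid_part s - v0_coord s *: x.

(** Incidence expresses [voo_coord s] through the other coordinates. It follows that a positive
    definite space of spheres through x is mapped injectively to normal vectors. *)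
Lemma sphere_normal_norm s x : ldot s (lightlike x) = 0 ->
  ldot s s = dot (sphere_normal x s) (sphere_normal x s).
Proof.
rewrite ldot_lightlike => h; rewrite /ldot /sphere_normal !dotE [dot x _]dotC.
have -> : voo_coord s = 2 * dot (euclid_part s) x - v0_coord s * dot x x by lra.
by field.
Qed.

(** Subtracting the two incidence equations gives 2 (y - x, N) = v0 (y - x, y - x) for the normal N
    at x and v0 the coordinate [v0_coord s], so the reflection subtracts v0 (y - x) from N. *)
Lemma sphere_normal_refl s x y : x != y ->
  ldot s (lightlike x) = 0 -> ldot s (lightlike y) = 0 ->
  sphere_normal y s = refl (y - x) (sphere_normal x s).
Proof.
move=> xy; rewrite !ldot_lightlike => hx hy.
rewrite /refl /sphere_normal.
have gg0 : dot (y - x) (y - x) != 0 by rewrite dot_eq0 subr_eq0 eq_sym.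
have -> : 2 * dot (y - x) (euclid_part s - v0_coord s *: x) =
    v0_coord s * dot (y - x) (y - x).
  move: hx hy; rewrite !dotE ![dot _ (euclid_part s)]dotC [dot y x]dotC; lra.
by rewrite mulfK // scalerBr opprB addrA subrK.
Qed.

Lemma sphere_normal_linear x : linear (sphere_normal x).
Proof.
move=> a s t; rewrite /sphere_normal euclid_partD euclid_partZ v0_coordD v0_coordZ.
by rewrite scalerDl scalerDr scalerN scalerA opprD addrACA.
Qed.

HB.instance Definition _ x := GRing.isLinear.Build R (lorentz R n) 'rV[R]_n *:%R
  (sphere_normal x) (sphere_normal_linear x).

Definition dot_pair e1 e2 (N : 'rV[R]_n) : 'rV[R]_2 :=
  \row_j dot N (if j == 0 then e1 else e2).

Lemma dot_pair_linear e1 e2 : linear (dot_pair e1 e2).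
Proof. by move=> a u v; apply/rowP => j; rewrite !mxE !dotE. Qed.

HB.instance Definition _ e1 e2 := GRing.isLinear.Build R 'rV[R]_n 'rV[R]_2 *:%R
  (dot_pair e1 e2) (dot_pair_linear e1 e2).

(** The kernel is the normal space of the plane spanned by [e1] and [e2]; Cramer's rule shows the
    map to be onto. The sum avoids the truncated difference [n - 2]. *)
Lemma dim_dot_pair e1 e2 : dot e1 e1 * dot e2 e2 - dot e1 e2 ^+ 2 != 0 ->
  (\dim (lker (linfun (dot_pair e1 e2))) + 2 = n)%N.
Proof.
move=> D0.
have := limg_ker_dim (linfun (dot_pair e1 e2)) fullv.
have dim_rV m : \dim {:'rV[R]_m} = m by rewrite dimvf /dim /= mul1n.
rewrite capfv dim_rV => dim_eq; apply: etrans dim_eq; congr (_ + _)%N.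
suff -> : limg (linfun (dot_pair e1 e2)) = fullv by rewrite dim_rV.
apply/eqP; rewrite eqEsubv subvf; apply/subvP => w _.
pose D := dot e1 e1 * dot e2 e2 - dot e1 e2 ^+ 2.
apply/memv_imgP; exists
  (((w 0 0 * dot e2 e2 - w 0 1 * dot e1 e2) / D) *: e1 +
   ((w 0 1 * dot e1 e1 - w 0 0 * dot e1 e2) / D) *: e2); first exact: memvf.
rewrite lfunE /=; apply/rowP => j; rewrite mxE.
have /orP[/eqP-> /=|/eqP-> /=] : (j == 0) || (j == 1) by case: j => -[|[|]].
  by rewrite !dotE [dot e2 e1]dotC /D; field.
by rewrite !dotE /D; field.
Qed.

(** Taking normals maps V injectively into the normal space, which has the same dimension n - 2. *)
Lemma sphere_normal_surj (V : {vspace lorentz R n}) x e1 e2 (N : 'rV[R]_n) :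
  \dim V = (n - 2)%N -> (forall s, s \in V -> s != 0 -> 0 < ldot s s) ->
  (forall s, s \in V -> ldot s (lightlike x) = 0) ->
  (forall s, s \in V -> dot (sphere_normal x s) e1 = 0) ->
  (forall s, s \in V -> dot (sphere_normal x s) e2 = 0) ->
  dot e1 e1 * dot e2 e2 - dot e1 e2 ^+ 2 != 0 ->
  dot N e1 = 0 -> dot N e2 = 0 -> exists2 s, s \in V & sphere_normal x s = N.
Proof.
move=> dimV posV Vx Ve1 Ve2 D0 N1 N2.
have dimK := dim_dot_pair D0.
pose K := lker (linfun (dot_pair e1 e2)).
have VK : (linfun (sphere_normal x) @: V <= K)%VS.
  apply/subvP => _ /memv_imgP[s sV ->]; rewrite memv_ker !lfunE /=.
  apply/eqP/rowP => j; rewrite !mxE; case: ifP => _; [exact: Ve1|exact: Ve2].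
have inj : (V :&: lker (linfun (sphere_normal x)) = 0)%VS.
  apply/eqP; rewrite -subv0; apply/subvP => s /memv_capP[sV].
  rewrite memv_ker lfunE /= memv0 => /eqP s0; apply/negPn/negP => s_neq0.
  by have := posV s sV s_neq0; rewrite (sphere_normal_norm (Vx s sV)) s0 dot0l ltxx.
have : N \in K.
  by rewrite memv_ker lfunE /=; apply/eqP/rowP => j; rewrite !mxE; case: ifP.
suff <- : (linfun (sphere_normal x) @: V)%VS = K.
  by move=> /memv_imgP[s sV ->]; exists s => //; rewrite lfunE.
apply/eqP; rewrite eqEdim VK /= (limg_dim_eq inj) dimV.
by have : (\dim K + 2 = n)%N := dimK; lia.
Qed.
End LorentzSphere.

(** * The function measuring the contact of a map with a sphere *)

Section ScalarDerivatives.
Variables (R : realType) (V : normedModType R).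
Implicit Types (f g : V -> R) (x v : V).

Lemma is_derive_addf f g x v df dg : is_derive x v f df -> is_derive x v g dg ->
  is_derive x v (fun y => f y + g y) (df + dg).
Proof. exact: is_deriveD. Qed.

Lemma is_derive_subf f g x v df dg : is_derive x v f df -> is_derive x v g dg ->
  is_derive x v (fun y => f y - g y) (df - dg).
Proof. exact: is_deriveB. Qed.

Lemma is_derive_mulf f g x v df dg : is_derive x v f df -> is_derive x v g dg ->
  is_derive x v (fun y => f y * g y) (df * g x + f x * dg).
Proof.
by move=> hf hg; apply: (is_derive_eq (is_deriveM hf hg)); rewrite addrC mulrC.
Qed.

Lemma is_derive_scalef c f x v df : is_derive x v f df ->
  is_derive x v (fun y => c * f y) (c * df).
Proof. exact: is_deriveZ. Qed.

Lemma is_derive_invf f x v df : f x != 0 -> is_derive x v f df ->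
  is_derive x v (fun y => (f y)^-1) (- (f x ^- 2 * df)).
Proof.
move=> f0 [fv <-]; apply: DeriveDef; first exact: derivableV.
by rewrite deriveV // -mulNr.
Qed.

End ScalarDerivatives.

Section ScalarDifferentiable.
Variables (R : realType) (V : normedModType R).
Implicit Types (f g : V -> R) (x : V).

Lemma differentiable_addf f g x : differentiable f x -> differentiable g x ->
  differentiable (fun y => f y + g y) x.
Proof. exact: differentiableD. Qed.

Lemma differentiable_subf f g x : differentiable f x -> differentiable g x ->
  differentiable (fun y => f y - g y) x.
Proof. exact: differentiableB. Qed.

Lemma differentiable_mulf f g x : differentiable f x -> differentiable g x ->
  differentiable (fun y => f y * g y) x.
Proof. exact: differentiableM. Qed.

Lemma differentiable_scalef c f x : differentiable f x ->
  differentiable (fun y => c * f y) x.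
Proof. exact: differentiableZ. Qed.

Lemma differentiable_invf f x : differentiable f x -> f x != 0 ->
  differentiable (fun y => (f y)^-1) x.
Proof. by move=> df f0; exact: differentiableV. Qed.

End ScalarDifferentiable.

Section SphereFunction.
Variables (R : realType) (V : normedModType R) (n : nat).
Implicit Types (F : V -> 'rV[R]_n) (s : lorentz R n) (U : set V).

Definition dir_diff F Y y : 'rV[R]_n := 'd F y Y.

Definition dir_diff2 F X Y y : 'rV[R]_n := 'd (dir_diff F Y) y X.

Section C2.
Variables (U : set V) (F : V -> 'rV[R]_n).
Hypothesis U_open : open U.
Hypothesis F_C2 : Ck 2 U F.

Lemma C2_differentiable x : U x -> differentiable F x.
Proof. by case: F_C2 => h _; exact: h. Qed.

Lemma C2_diff_differentiable Y x : U x -> differentiable (dir_diff F Y) x.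
Proof. by case: F_C2 => _ /(_ Y) [h _]; exact: h. Qed.

Lemma C2_continuous X Y x : U x ->
  {for x, continuous (dir_diff2 F X Y)}.
Proof. by case: F_C2 => _ /(_ Y) [_ /(_ X) h]; exact: h. Qed.

Lemma C2_symmetric X Y x : U x ->
  dir_diff2 F X Y x = dir_diff2 F Y X x.
Proof.
move=> Ux; apply/rowP => i.
have UN : \forall y \near x, U y by exact: open_nbhs_nbhs.
have D1 Z : \forall y \near x, is_derive y Z (fun y => F y 0 i) (dir_diff F Z y 0 i).
  by near=> y; apply/is_derive_coord/diff_is_derive/C2_differentiable; near: y.
have D2 Z W : \forall y \near x, is_derive y Z (fun y => dir_diff F W y 0 i)
    (dir_diff2 F Z W y 0 i).
  near=> y; apply: (@is_derive_coord _ _ _ _ (dir_diff F W)).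
  by apply/diff_is_derive/C2_diff_differentiable; near: y.
have c Z W : {for x, continuous (fun y => dir_diff2 F Z W y 0 i)}.
  apply: (@continuous_comp _ _ _ (dir_diff2 F Z W)
    (fun N : 'rV[R]_n => N 0 i)); first exact: C2_continuous.
  exact: coord_continuous.
exact: (schwarz (D1 Y) (D1 X) (D2 X Y) (D2 Y X) (c X Y) (c Y X)).
Unshelve. all: by end_near. Qed.

End C2.

(* The sphere s has first order contact with F at y exactly when this function
   of y vanishes to first order. *)
Definition contact F s y : R := ldot s (lightlike (F y)).

Definition dcontact F s Y y : R :=
  dot (euclid_part s) (dir_diff F Y y) - v0_coord s * dot (F y) (dir_diff F Y y).

(* At a point of contact, this is the second form of F along the normal vector
   of the sphere, up to a multiple of the metric. *)
Definition ddcontact F s X Y y : R :=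
  dot (sphere_normal (F y) s) (dir_diff2 F X Y y)
    - v0_coord s * dot (dir_diff F X y) (dir_diff F Y y).

Lemma contactE F s : contact F s = (fun y => dot ((cst (euclid_part s) : V -> 'rV_n) y) (F y)
  - (2^-1 * v0_coord s) * dot (F y) (F y) - 2^-1 * voo_coord s).
Proof. by apply/funext => z; rewrite /contact ldot_lightlike /=; ring. Qed.

Lemma contact_differentiable F s y : differentiable F y -> differentiable (contact F s) y.
Proof.
move=> hF; have c (W : normedModType R) (w : W) : differentiable (cst w : V -> W) y.
  exact: differentiable_cst.
rewrite contactE; apply: differentiable_subf; last exact: c.
apply: differentiable_subf; first exact: differentiable_dot.
by apply: differentiable_scalef; exact: differentiable_dot.
Qed.

Lemma is_derive_contact F s Y y : differentiable F y ->
  is_derive y Y (contact F s) (dcontact F s Y y).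
Proof.
move=> /(@diff_is_derive _ _ _ _ _ Y) hF; rewrite contactE.
have h1 := is_derive_dot (is_derive_cst (euclid_part s) y Y) hF.
have h2 := is_derive_dot hF hF.
apply: (is_derive_eq (is_derive_subf (is_derive_subf h1 (is_derive_scalef _ h2))
  (is_derive_cst _ _ _))).
by rewrite dot0l /dcontact [dot ('d _ _ _) _]dotC /=; field.
Qed.

Lemma is_derive_dcontact F s X Y y :
  differentiable F y -> differentiable (dir_diff F Y) y ->
  is_derive y X (dcontact F s Y) (ddcontact F s X Y y).
Proof.
move=> /(@diff_is_derive _ _ _ _ _ X) hF /(@diff_is_derive _ _ _ _ _ X) hdF.
have h1 := is_derive_dot (is_derive_cst (euclid_part s) y X) hdF.
have h2 := is_derive_dot hF hdF.
apply: (is_derive_eq (is_derive_subf h1 (is_derive_scalef (v0_coord s) h2))).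
rewrite dot0l add0r /ddcontact /sphere_normal !dotE /=.
by ring.
Qed.

Lemma ddcontactC U F s X Y y : open U -> Ck 2 U F -> U y ->
  ddcontact F s X Y y = ddcontact F s Y X y.
Proof.
move=> Uo FC Uy.
rewrite /ddcontact (C2_symmetric Uo FC X Y Uy).
by congr (_ - _ * _); exact: dotC.
Qed.

End SphereFunction.

(** * Pairs of surfaces enveloping a congruence, in coordinates *)

Lemma near_derive_unique (R : realType) (V : normedModType R) (f g : V -> R) x v df dg :
  (\near x, f x = g x) -> is_derive x v f df -> is_derive x v g dg -> df = dg.
Proof.
by move=> fg hf hg; have [_ <-] := near_eq_is_derive fg hf; have [_ <-] := hg.
Qed.

Lemma ex_derive (R : realType) (V : normedModType R) (f : V -> R) x v :
  differentiable f x -> exists df, is_derive x v f df.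
Proof. by move=> hf; exists ('d f x v); exact: diff_is_derive. Qed.

Section EnvelopingPair.
Variables (R : realType) (V : normedModType R) (n : nat) (u1 u2 : V).
Variables (F F' : V -> 'rV[R]_n).

Let g y := F' y - F y.
Let e1 := dir_diff F u1.
Let e2 := dir_diff F u2.

Definition gram y := dot (e1 y) (e1 y) * dot (e2 y) (e2 y) - dot (e1 y) (e2 y) ^+ 2.

(** This is (rho d_Y F', d_Z F), see [mixedE], written out so that its differentiability in y can be
    read off. *)
Definition mixed Y Z y :=
  dot (dir_diff F' Y y) (dir_diff F Z y)
    - 2 * dot (g y) (dir_diff F' Y y) * dot (g y) (dir_diff F Z y) * (dot (g y) (g y))^-1.

(* The coordinates of rho (d_Y F') in the basis (e1, e2), see refl_tangent. *)
Definition coef1 Y y :=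
  (mixed Y u1 y * dot (e2 y) (e2 y) - mixed Y u2 y * dot (e1 y) (e2 y)) / gram y.

Definition coef2 Y y :=
  (mixed Y u2 y * dot (e1 y) (e1 y) - mixed Y u1 y * dot (e1 y) (e2 y)) / gram y.

(** The coefficient of g that appears when [coef1 Y *: e1 + coef2 Y *: e2] is reflected back to d_Y
    F'. It becomes the 1-form th when B is scalar. *)
Definition gap_coef Y y :=
  - (2 * (coef1 Y y * dot (g y) (e1 y) + coef2 Y y * dot (g y) (e2 y)) / dot (g y) (g y)).

Variable U : set V.
Hypothesis U_open : open U.
Hypothesis F_C2 : Ck 2 U F.
Hypothesis F'_C2 : Ck 2 U F'.
Hypothesis F_free : forall x a b, U x -> a *: e1 x + b *: e2 x = 0 -> a = 0 /\ b = 0.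
Hypothesis g_neq0 : forall x, U x -> g x != 0.
Hypothesis normal_refl : forall x N Y, U x -> dot N (e1 x) = 0 ->
  dot N (e2 x) = 0 -> dot (refl (g x) N) (dir_diff F' Y x) = 0.

Lemma mixedE Y Z x : mixed Y Z x = dot (refl (g x) (dir_diff F' Y x)) (dir_diff F Z x).
Proof. by rewrite /refl dotBl dotZl /mixed; ring. Qed.

Lemma gram_pos x : U x -> [/\ 0 < dot (e1 x) (e1 x), 0 < dot (e2 x) (e2 x) & 0 < gram x].
Proof. by move=> Ux; apply: gram_gt0 => a b; exact: F_free. Qed.

Lemma refl_tangent Y x : U x ->
  refl (g x) (dir_diff F' Y x) = coef1 Y x *: e1 x + coef2 Y x *: e2 x.
Proof.
move=> Ux; have [_ _ G0] := gram_pos Ux; rewrite /coef1 /coef2 !mixedE.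
apply: tangent_coords => [|N N1 N2]; first by rewrite gt_eqF.
by rewrite -refl_dot normal_refl.
Qed.

Lemma frame Y x : U x ->
  dir_diff F' Y x = coef1 Y x *: e1 x + coef2 Y x *: e2 x + gap_coef Y x *: g x.
Proof.
move=> Ux; have /(congr1 (refl (g x))) := refl_tangent Y Ux.
rewrite reflK ?g_neq0 // => ->; rewrite {1}/refl dotDr !dotZr.
by rewrite /gap_coef -scaleNr mulrAC.
Qed.

(** The decomposition in [frame] lifts to the light cone, with phi' - phi in place of g; here it is
    paired with a constant vector s. The value of [gap_coef] is exactly what makes the quadratic
    terms agree. *)
Lemma contact_frame s Y x : U x -> dcontact F' s Y x =
  coef1 Y x * dcontact F s u1 x + coef2 Y x * dcontact F s u2 x
    + gap_coef Y x * (contact F' s x - contact F s x).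
Proof.
move=> Ux; rewrite /dcontact /contact !ldot_lightlike (frame Y Ux).
have gg : dot (g x) (g x) != 0 by rewrite dot_eq0 g_neq0.
have e : F' x = F x + g x by rewrite addrCA subrr addr0.
have hth : coef1 Y x * dot (g x) (e1 x) + coef2 Y x * dot (g x) (e2 x)
    = - (2^-1 * gap_coef Y x * dot (g x) (g x)).
  by rewrite /gap_coef; field.
rewrite -/e1 -/e2 e; move: (g x) gg hth => gx gg hth.
rewrite !dotE [dot gx (F x)]dotC.
transitivity (coef1 Y x * (dot (euclid_part s) (e1 x) - v0_coord s * dot (F x) (e1 x))
  + coef2 Y x * (dot (euclid_part s) (e2 x) - v0_coord s * dot (F x) (e2 x))
  + gap_coef Y x * (dot (euclid_part s) gx) - v0_coord s *
   ((coef1 Y x * dot gx (e1 x) + coef2 Y x * dot gx (e2 x)) +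
    gap_coef Y x * (dot (F x) gx + dot gx gx))); first by ring.
by rewrite hth; field.
Qed.

Let F_diff x : U x -> differentiable F x. Proof. exact: C2_differentiable. Qed.
Let F'_diff x : U x -> differentiable F' x. Proof. exact: C2_differentiable. Qed.
Let d1F_diff Y x : U x -> differentiable (dir_diff F Y) x.
Proof. exact: C2_diff_differentiable. Qed.
Let d1F'_diff Y x : U x -> differentiable (dir_diff F' Y) x.
Proof. exact: C2_diff_differentiable. Qed.
Let g_diff x : U x -> differentiable g x.
Proof. by move=> Ux; apply: differentiableB; [exact: F'_diff|exact: F_diff]. Qed.

Lemma mixed_differentiable Y Z x : U x -> differentiable (mixed Y Z) x.
Proof.
move=> Ux; have gx := g_diff Ux; have dF := d1F_diff Z Ux; have dF' := d1F'_diff Y Ux.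
apply: differentiable_subf; first exact: differentiable_dot.
apply: differentiable_mulf; last first.
  by apply: differentiable_invf; [exact: differentiable_dot|rewrite dot_eq0 g_neq0].
apply: differentiable_mulf; last exact: differentiable_dot.
by apply: differentiable_scalef; exact: differentiable_dot.
Qed.

Lemma gram_differentiable x : U x -> differentiable gram x.
Proof.
move=> Ux; have h1 := d1F_diff u1 Ux; have h2 := d1F_diff u2 Ux.
by apply: differentiable_subf; apply: differentiable_mulf; exact: differentiable_dot.
Qed.

Lemma coef1_differentiable Y x : U x -> differentiable (coef1 Y) x.
Proof.
move=> Ux; have h1 := d1F_diff u1 Ux; have h2 := d1F_diff u2 Ux.
have [_ _ G0] := gram_pos Ux.
apply: differentiable_mulf; last first.
  by apply: differentiable_invf; [exact: gram_differentiable|rewrite gt_eqF].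
by apply: differentiable_subf; apply: differentiable_mulf;
  by [exact: mixed_differentiable|exact: differentiable_dot].
Qed.

Lemma coef2_differentiable Y x : U x -> differentiable (coef2 Y) x.
Proof.
move=> Ux; have h1 := d1F_diff u1 Ux; have h2 := d1F_diff u2 Ux.
have [_ _ G0] := gram_pos Ux.
apply: differentiable_mulf; last first.
  by apply: differentiable_invf; [exact: gram_differentiable|rewrite gt_eqF].
by apply: differentiable_subf; apply: differentiable_mulf;
  by [exact: mixed_differentiable|exact: differentiable_dot].
Qed.

Lemma gap_coef_differentiable Y x : U x -> differentiable (gap_coef Y) x.
Proof.
move=> Ux; have h1 := d1F_diff u1 Ux; have h2 := d1F_diff u2 Ux; have gx := g_diff Ux.
apply: differentiableN; apply: differentiable_mulf; last first.
  by apply: differentiable_invf; [exact: differentiable_dot|rewrite dot_eq0 g_neq0].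
apply: differentiable_scalef; apply: differentiable_addf; apply: differentiable_mulf.
- exact: coef1_differentiable.
- exact: differentiable_dot.
- exact: coef2_differentiable.
- exact: differentiable_dot.
Qed.

(** This is L' = B L. It comes from differentiating [contact_frame] along X: first order contact
    kills every term containing a derivative of a coefficient. *)
Lemma second_form_frame s X Y x : U x ->
  contact F s x = 0 -> contact F' s x = 0 -> dcontact F s u1 x = 0 -> dcontact F s u2 x = 0 ->
  dcontact F s X x = 0 -> dcontact F' s X x = 0 ->
  ddcontact F' s X Y x = coef1 Y x * ddcontact F s X u1 x + coef2 Y x * ddcontact F s X u2 x.
Proof.
move=> Ux p0 p'0 dp1 dp2 dpX dp'X.
have UN : \forall y \near x, U y by exact: open_nbhs_nbhs.
have [a1 h1] := ex_derive X (coef1_differentiable Y Ux).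
have [a2 h2] := ex_derive X (coef2_differentiable Y Ux).
have [a3 h3] := ex_derive X (gap_coef_differentiable Y Ux).
have hL := is_derive_dcontact s X (F'_diff Ux) (d1F'_diff Y Ux).
have hR := is_derive_addf (is_derive_addf
  (is_derive_mulf h1 (is_derive_dcontact s X (F_diff Ux) (d1F_diff u1 Ux)))
  (is_derive_mulf h2 (is_derive_dcontact s X (F_diff Ux) (d1F_diff u2 Ux))))
  (is_derive_mulf h3 (is_derive_subf (is_derive_contact s X (F'_diff Ux))
    (is_derive_contact s X (F_diff Ux)))).
rewrite (near_derive_unique _ hL hR) ?p0 ?p'0 ?dp1 ?dp2 ?dpX ?dp'X.
  by rewrite !subr0 !mulr0 !add0r addr0.
by near=> y; rewrite contact_frame //; near: y.
Unshelve. all: by end_near. Qed.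

(** * The case B = mu id *)

Definition scalar_at y := [/\ coef2 u1 y = 0, coef1 u2 y = 0 & coef2 u2 y = coef1 u1 y].
Let mu := coef1 u1.

Lemma contact_scalar s y : U y -> scalar_at y ->
  dcontact F' s u1 y = mu y * dcontact F s u1 y
    + gap_coef u1 y * (contact F' s y - contact F s y) /\
  dcontact F' s u2 y = mu y * dcontact F s u2 y
    + gap_coef u2 y * (contact F' s y - contact F s y).
Proof.
move=> Uy [b21 b12 b22]; rewrite !contact_frame // b21 b12 b22 !mul0r.
by rewrite addr0 add0r.
Qed.

Section ScalarNear.
Variable x : V.
Hypothesis Ux : U x.
Hypothesis scalar_near : \forall y \near x, scalar_at y.

Let U_near : \forall y \near x, U y. Proof. exact: open_nbhs_nbhs. Qed.

Let ddcontact_scalar s X u c m t : is_derive x X mu m -> is_derive x X (gap_coef u) t ->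
  (forall y, U y -> scalar_at y -> dcontact F' s u y =
    mu y * dcontact F s u y + gap_coef u y * (contact F' s y - contact F s y)) ->
  c = dcontact F' s X x - dcontact F s X x ->
  ddcontact F' s X u x = m * dcontact F s u x + mu x * ddcontact F s X u x
    + (t * (contact F' s x - contact F s x) + gap_coef u x * c).
Proof.
move=> hm ht hu ->.
have hL := is_derive_dcontact s X (F'_diff Ux) (d1F'_diff u Ux).
have hR := is_derive_addf
  (is_derive_mulf hm (is_derive_dcontact s X (F_diff Ux) (d1F_diff u Ux)))
  (is_derive_mulf ht (is_derive_subf (is_derive_contact s X (F'_diff Ux))
    (is_derive_contact s X (F_diff Ux)))).
apply: (near_derive_unique _ hL hR); near=> y; apply: hu; near: y => //.
Unshelve. all: by end_near. Qed.

(* The equation d(d phi') = 0, written in the frame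
   (d_1 phi, d_2 phi, phi' - phi). *)
Lemma derive_scalar : is_derive x u1 mu ((mu x - 1) * gap_coef u1 x) /\
  is_derive x u2 mu ((mu x - 1) * gap_coef u2 x).
Proof.
have [m1 hm1] := ex_derive u1 (coef1_differentiable u1 Ux).
have [m2 hm2] := ex_derive u2 (coef1_differentiable u1 Ux).
have [t21 ht21] := ex_derive u2 (gap_coef_differentiable u1 Ux).
have [t12 ht12] := ex_derive u1 (gap_coef_differentiable u2 Ux).
have sx := nbhs_singleton scalar_near.
(* Equality of the two mixed second derivatives of phi', paired with an arbitrary s. *)
have key s : (m2 - gap_coef u2 x * (mu x - 1)) * dcontact F s u1 x
    - (m1 - gap_coef u1 x * (mu x - 1)) * dcontact F s u2 x
    + (t21 - t12) * (contact F' s x - contact F s x) = 0.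
  have q1 := ddcontact_scalar hm2 ht21 (fun y Uy sy => (contact_scalar s Uy sy).1) erefl.
  have q2 := ddcontact_scalar hm1 ht12 (fun y Uy sy => (contact_scalar s Uy sy).2) erefl.
  have [p1 p2] := contact_scalar s Ux sx.
  rewrite (ddcontactC s u1 u2 U_open F'_C2 Ux) (ddcontactC s u1 u2 U_open F_C2 Ux) in q2.
  rewrite p2 in q1; rewrite p1 in q2; move: (etrans (esym q1) q2).
  by move/eqP; rewrite -subr_eq0 => /eqP <-; ring.
have [E0 H0 G0] := gram_pos Ux.
have gg : dot (g x) (g x) != 0 by rewrite dot_eq0 g_neq0.
(* The choice s = phi(x) is orthogonal to phi and to d phi at x, which isolates the coefficient of
   phi' - phi. *)
have tt : t21 = t12.
  have := key (lightlike (F x)).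
  rewrite /dcontact /contact euclid_part_lightlike v0_coord_lightlike !mul1r !subrr !mulr0.
  rewrite subrr add0r ldot_lightlike2 (ldot_lightlike2 (F x) (F x)) subrr dot0l.
  rewrite mulr0 subr0.
  move/eqP; rewrite !mulf_eq0 oppr_eq0 invr_eq0 pnatr_eq0 (negbTE gg) !orbF subr_eq0.
  by move/eqP.
(* Euclidean vectors now separate the two remaining coefficients, as [e1] and [e2] are
   independent. *)
have {}key a : (m2 - gap_coef u2 x * (mu x - 1)) * dot a (e1 x)
    - (m1 - gap_coef u1 x * (mu x - 1)) * dot a (e2 x) = 0.
  have := key (euclid a); rewrite /dcontact euclid_part_euclid v0_coord_euclid.
  by rewrite !mul0r !subr0 tt subrr mul0r addr0.
have k1 := key (e1 x); have k2 := key (e2 x); rewrite [dot (e2 x) _]dotC in k2.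
move: k1 k2 G0; rewrite /gram; set E := dot (e1 x) (e1 x).
set H := dot (e2 x) (e2 x); set Fm := dot (e1 x) (e2 x).
set A := m2 - _; set B := m1 - _ => k1 k2 G0.
have A0 : A = 0.
  have /eqP : A * (E * H - Fm ^+ 2) = 0.
    transitivity (H * (A * E - B * Fm) - Fm * (A * Fm - B * H)); first by ring.
    by rewrite k1 k2 !mulr0 subrr.
  by rewrite mulf_eq0 (gt_eqF G0) orbF => /eqP.
have B0 : B = 0.
  have /eqP : B * (E * H - Fm ^+ 2) = 0.
    transitivity (Fm * (A * E - B * Fm) - E * (A * Fm - B * H)); first by ring.
    by rewrite k1 k2 !mulr0 subrr.
  by rewrite mulf_eq0 (gt_eqF G0) orbF => /eqP.
split; [move: hm1|move: hm2]; rewrite mulrC.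
  by move/eqP: B0; rewrite subr_eq0 => /eqP ->.
by move/eqP: A0; rewrite subr_eq0 => /eqP ->.
Qed.

Definition omega s y := contact F' s y - mu y * contact F s y.

(** [omega s] is the pairing of s with w = phi' - mu phi, and d mu = (mu - 1) th turns th (phi' -
    phi) - d mu phi into th w. *)
Lemma derive_omega s :
  is_derive x u1 (omega s) (gap_coef u1 x * omega s x) /\
  is_derive x u2 (omega s) (gap_coef u2 x * omega s x).
Proof.
have [hm1 hm2] := derive_scalar.
have [p1 p2] := contact_scalar s Ux (nbhs_singleton scalar_near).
split.
- apply: (is_derive_eq (is_derive_subf (is_derive_contact s u1 (F'_diff Ux))
    (is_derive_mulf hm1 (is_derive_contact s u1 (F_diff Ux))))).
  by rewrite p1 /omega; ring.
- apply: (is_derive_eq (is_derive_subf (is_derive_contact s u2 (F'_diff Ux))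
    (is_derive_mulf hm2 (is_derive_contact s u2 (F_diff Ux))))).
  by rewrite p2 /omega; ring.
Qed.

End ScalarNear.

Hypothesis span_u : forall v, exists a b, v = a *: u1 + b *: u2.

Lemma omega_differentiable s x : U x -> differentiable (omega s) x.
Proof.
move=> Ux; apply: differentiable_subf; first exact/contact_differentiable/F'_diff.
apply: differentiable_mulf; first exact: coef1_differentiable.
exact/contact_differentiable/F_diff.
Qed.

(* The logarithmic derivative of omega s does not depend on s, so the ratio of
   two such functions is constant on a ball. *)
Lemma omega_line p : U p -> (\forall y \near p, scalar_at y) ->
  \forall y \near p, exists2 k, k != 0 & forall s, omega s y = k * omega s p.
Proof.
(* This s serves as denominator: [omega s0 p] is - (g, g) / 2 at p, hence nonzero near p. *)
move=> Up sp; pose s0 := lightlike (F p).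
have w0 : omega s0 p != 0.
  rewrite /omega /contact !ldot_lightlike2 subrr dot0l !mulr0 subr0.
  by rewrite mulf_neq0 // ?oppr_eq0 ?invr_eq0 ?pnatr_eq0 // dot_eq0 g_neq0.
have U_near : \forall y \near p, U y by exact: open_nbhs_nbhs.
have w0_near : \forall y \near p, omega s0 y != 0.
  have := differentiable_continuous (omega_differentiable s0 Up).
  by move=> /(_ _ (open_nbhs_nbhs (conj (@open_neq _ 0) w0))).
(* [derive_omega] asks for B to be scalar in a neighbourhood of each point of the ball. *)
have s_near := near_join sp.
have [r /= r0 hr] := (nbhs_ballP _ _).1 (filterI U_near (filterI w0_near s_near)).
apply/nbhs_ballP; exists r => //= y py.
have [Uy [w0y _]] := hr y py.
exists (omega s0 y / omega s0 p); first by rewrite mulf_neq0 ?invr_eq0.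
move=> s; have : omega s y * (omega s0 y)^-1 = omega s p * (omega s0 p)^-1.
  apply: (is_derive0_ball (f := fun z => omega s z * (omega s0 z)^-1) _ py).
  move=> x v px; have [Ux [w0x sx]] := hr x px.
  have [a [b ->]] := span_u v.
  have dw t : is_derive x (a *: u1 + b *: u2) (omega t)
      ((a * gap_coef u1 x + b * gap_coef u2 x) * omega t x).
    have wd := omega_differentiable t Ux.
    have [[_ h1] [_ h2]] := derive_omega Ux sx t.
    apply: (is_derive_eq (diff_is_derive _ wd)).
    by rewrite linearD !linearZ -!deriveE // h1 h2 mulrDl -!mulrA.
  apply: (is_derive_eq (is_derive_mulf (dw s) (is_derive_invf w0x (dw s0)))).
  by field.
move=> e; rewrite mulrAC -mulrA [omega s p / _]mulrC -[X in _ * X]mulrC -e.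
by rewrite mulrCA mulfV // mulr1.
Qed.

(** * The determinant of B and the consequences of conformality *)

Definition bdet x := coef1 u1 x * coef2 u2 x - coef2 u1 x * coef1 u2 x.

(** It equals det B times the positive Gram determinant, so it has the sign of det B; being bilinear
    in the differentials, it suits continuity and changes of chart. *)
Definition mixed_det x := mixed u1 u1 x * mixed u2 u2 x - mixed u1 u2 x * mixed u2 u1 x.

Lemma mixed_detE x : U x -> mixed_det x = bdet x * gram x.
Proof.
move=> Ux; rewrite /mixed_det !mixedE !(refl_tangent _ Ux) !dotDl !dotZl.
by rewrite /bdet /gram -/e1 -/e2 [dot (e2 x) (e1 x)]dotC; ring.
Qed.

Lemma mixed_det_gt0 x : U x -> (0 < mixed_det x) = (0 < bdet x).
Proof. by move=> Ux; have [_ _ G0] := gram_pos Ux; rewrite mixed_detE // pmulr_lgt0. Qed.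

Lemma mixed_det_continuous x : U x -> {for x, continuous mixed_det}.
Proof.
move=> Ux; apply: differentiable_continuous; apply: differentiable_subf;
  by apply: differentiable_mulf; exact: mixed_differentiable.
Qed.

Lemma refl_scalar x : U x -> scalar_at x ->
  refl (g x) (dir_diff F' u1 x) = mu x *: dir_diff F u1 x /\
  refl (g x) (dir_diff F' u2 x) = mu x *: dir_diff F u2 x.
Proof.
move=> Ux [b21 b12 b22]; rewrite !refl_tangent // b21 b12 b22 !scale0r.
by rewrite addr0 add0r.
Qed.

Section Conformal.
Variables (x : V) (l : R).
Hypothesis Ux : U x.
Hypothesis l_gt0 : 0 < l.
Hypothesis conformal : forall Y Z,
  dot (dir_diff F' Y x) (dir_diff F' Z x) = l * dot (dir_diff F Y x) (dir_diff F Z x).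

Let E := dot (e1 x) (e1 x).
Let Fm := dot (e1 x) (e2 x).
Let H := dot (e2 x) (e2 x).

(** As rho is an isometry, conformality of F and F' reads B G B^T = l G. *)
Let conformal_b Y Z : l * dot (dir_diff F Y x) (dir_diff F Z x) =
  coef1 Y x * (coef1 Z x * E + coef2 Z x * Fm) + coef2 Y x * (coef1 Z x * Fm + coef2 Z x * H).
Proof.
rewrite -conformal -(refl_isometry _ _ (g_neq0 Ux)) !(refl_tangent _ Ux).
by rewrite !dotDl !dotDr !dotZl !dotZr [dot (e2 x) (e1 x)]dotC /E /Fm /H; ring.
Qed.

Lemma bdet_neq0 : bdet x != 0.
Proof.
have [_ _ G0] := gram_pos Ux.
have [e|e] := conformal_det G0 (esym (conformal_b u1 u1))
  (esym (conformal_b u1 u2)) (esym (conformal_b u2 u2)).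
  by rewrite /bdet e gt_eqF.
by rewrite /bdet e oppr_eq0 gt_eqF.
Qed.

(** The Darboux equation up to the factor 1 / (g, g): B is trace free and symmetric by
    [anticonformal]. *)
Lemma bdet_lt0_comm : bdet x < 0 -> forall a b c d,
  cvec (a *: e1 x + b *: e2 x)
    * cvec (refl (g x) (c *: dir_diff F' u1 x + d *: dir_diff F' u2 x))
  = cvec (c *: e1 x + d *: e2 x)
    * cvec (refl (g x) (a *: dir_diff F' u1 x + b *: dir_diff F' u2 x)).
Proof.
move=> d0; have [E0 H0 G0] := gram_pos Ux.
have [tr0 sym] := anticonformal E0 G0 l_gt0 (esym (conformal_b u1 u1))
  (esym (conformal_b u1 u2)) (esym (conformal_b u2 u2)) d0.
move=> a b c d; rewrite !reflD !reflZ !(refl_tangent _ Ux).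
have c1 p q : p *: (coef1 u1 x *: e1 x + coef2 u1 x *: e2 x)
     + q *: (coef1 u2 x *: e1 x + coef2 u2 x *: e2 x)
   = (p * coef1 u1 x + q * coef1 u2 x) *: e1 x + (p * coef2 u1 x + q * coef2 u2 x) *: e2 x.
  by rewrite !scalerDr !scalerA addrACA -!scalerDl.
by rewrite !c1; exact: cvec_tracefree_comm.
Qed.

(** [ribaucour_dichotomy] for the Hessian L of (s, phi); when L vanishes, so does L' = B L. *)
Lemma bdet_gt0_dichotomy s : 0 < bdet x -> contact F s x = 0 -> contact F' s x = 0 ->
  (forall Y, dcontact F s Y x = 0) -> (forall Y, dcontact F' s Y x = 0) ->
  let p11 := ddcontact F s u1 u1 x * H - ddcontact F s u1 u2 x * Fm in
  let p12 := ddcontact F s u1 u2 x * E - ddcontact F s u1 u1 x * Fm in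
  let p22 := ddcontact F s u2 u2 x * E - ddcontact F s u2 u1 x * Fm in
  let q11 := ddcontact F' s u1 u1 x * H - ddcontact F' s u1 u2 x * Fm in
  let q12 := ddcontact F' s u1 u2 x * E - ddcontact F' s u1 u1 x * Fm in
  let q22 := ddcontact F' s u2 u2 x * E - ddcontact F' s u2 u1 x * Fm in
  p11 * q12 + p12 * q22 = q11 * p12 + q12 * p22 ->
  scalar_at x \/ [/\ ddcontact F s u1 u1 x = 0, ddcontact F s u1 u2 x = 0,
    ddcontact F s u2 u1 x = 0 & ddcontact F s u2 u2 x = 0] /\
   [/\ ddcontact F' s u1 u1 x = 0, ddcontact F' s u1 u2 x = 0,
    ddcontact F' s u2 u1 x = 0 & ddcontact F' s u2 u2 x = 0].
Proof.
move=> d0 p0 p'0 dp0 dp'0; have [E0 H0 G0] := gram_pos Ux.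
have L' X Y := second_form_frame Y Ux p0 p'0 (dp0 u1) (dp0 u2) (dp0 X) (dp'0 X).
have LC := ddcontactC s u2 u1 U_open F_C2 Ux.
(* The Hessian of (s, phi') is symmetric too, which says that B L is symmetric. *)
have L'C : coef1 u1 x * ddcontact F s u1 u2 x + coef2 u1 x * ddcontact F s u2 u2 x
   = coef1 u2 x * ddcontact F s u1 u1 x + coef2 u2 x * ddcontact F s u1 u2 x.
  rewrite -[in LHS]LC.
  exact: etrans (esym (L' u2 u1)) (etrans (ddcontactC s u2 u1 U_open F'_C2 Ux) (L' u1 u2)).
move=> /= c12.
have [||[a0 b0 c0]] := ribaucour_dichotomy E0 G0 l_gt0 (esym (conformal_b u1 u1))
  (esym (conformal_b u1 u2)) (esym (conformal_b u2 u2)) d0 L'C.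
- apply/eqP; rewrite -subr_eq0; move/eqP: c12; rewrite -subr_eq0.
  have L'21 := L' u2 u1; rewrite LC in L'21.
  rewrite (L' u1 u1) (etrans (L' u1 u2) (esym L'C)) (etrans L'21 L'C) (L' u2 u2) LC.
  by rewrite /H /E /Fm => /eqP <-; apply/eqP; ring.
- by move=> [h1 h2 h3]; left; split; [exact: h1|exact: h2|exact: esym h3].
- right; have z p q : p * 0 + q * 0 = 0 :> R by rewrite !mulr0 addr0.
  split; split.
  + exact: a0.
  + exact: b0.
  + exact: etrans LC b0.
  + exact: c0.
  + by rewrite (L' u1 u1) a0 b0 z.
  + by rewrite (L' u1 u2) a0 b0 z.
  + by rewrite (L' u2 u1) LC b0 c0 z.
  + by rewrite (L' u2 u2) LC b0 c0 z.
Qed.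

End Conformal.

End EnvelopingPair.

(** The shape operators are L G^-1 + a and - (l^-1 L' G^-1 + a); added scalars and nonzero factors
    do not affect commutation. *)
Lemma shape_commute (K : fieldType) (L L' II II' G G' : 'M[K]_2) (a l : K) :
  G \in unitmx -> l != 0 -> G' = l *: G ->
  II = L + a *: G -> II' = L' + a *: G' ->
  comm_mx (II *m invmx G) (- II' *m invmx G') ->
  comm_mx (L *m invmx G) (L' *m invmx G).
Proof.
move=> Gu l0 -> -> ->; have Gi : invmx (l *: G) = l^-1 *: invmx G.
  by rewrite invmxZ // unitmxZ ?unitfE.
set P := L *m _; set P' := L' *m _.
have -> : (L + a *: G) *m invmx G = P + a%:M.
  by rewrite mulmxDl -scalemxAl mulmxV // scalemx1.
have -> : - (L' + a *: (l *: G)) *m invmx (l *: G) = - (l^-1 *: P' + a%:M).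
  rewrite mulNmx Gi mulmxDl -!scalemxAl -!scalemxAr mulmxV //.
  by rewrite !scalerA mulfK // scalemx1.
move=> /comm_mxN; rewrite opprK => h.
have {h} /comm_mx_sym h : comm_mx (P + a%:M) (l^-1 *: P').
  by rewrite -[_ *: P'](addrK a%:M); exact/comm_mxB/comm_mx_scalar.
have {h} /comm_mx_sym h : comm_mx (l^-1 *: P') P.
  by rewrite -[P](addrK a%:M); exact/comm_mxB/comm_mx_scalar.
have -> : P' = l *: (l^-1 *: P') by rewrite scalerA mulfV // scale1r.
by rewrite /comm_mx -scalemxAr h scalemxAl.
Qed.

(** The vector m swaps the two light-like coordinates of s and scales them by - 1/2. The product
    rule for [dot] thus applies to [ldot s]. *)
Lemma ldot_dot (R : realType) n (s : lorentz R n) : exists m : lorentz R n,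
  forall v, ldot s v = dot m v.
Proof.
exists (row_mx (euclid_part s) (row_mx (const_mx (- (2^-1 * voo_coord s)))
  (const_mx (- (2^-1 * v0_coord s))))) => v.
have -> : ldot s v = (\sum_i euclid_part s 0 i * v 0 (lshift _ i))
    - 2^-1 * (v0_coord s * v 0 (rshift n (rshift 1 0))
              + voo_coord s * v 0 (rshift n (lshift 1 0))).
  rewrite /ldot /v0_coord /voo_coord !mxE; congr (_ - _).
  by apply: eq_bigr => i _; rewrite [euclid_part v 0 i]mxE.
rewrite /dot big_split_ord big_split_ord /= !big_ord1 !row_mxEr row_mxEl !mxE.
under [in RHS]eq_bigr => i _ do rewrite row_mxEl.
by rewrite [ord0]ord1; ring.
Qed.

Lemma euclid_sum (R : realType) n (x : 'rV[R]_n) :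
  euclid x = \sum_i x 0 i *: row i (row_mx 1%:M 0).
Proof. by rewrite -mulmx_sum_row mul_mx_row mulmx1 mulmx0. Qed.

Lemma lightlike_differentiable (R : realType) (V : normedModType R) n (F : V -> 'rV[R]_n) x :
  differentiable F x -> differentiable (@lightlike R n \o F) x.
Proof.
move=> dF; have -> : @lightlike R n \o F =
    (\sum_(i < n) (fun y => F y 0 i *: row i (row_mx 1%:M 0)))
    + cst (@v0 R n) + (fun y => dot (F y) (F y) *: @voo R n).
  by apply/funext => y; rewrite /= /lightlike euclid_sum !fctE /= fct_sumE.
apply: differentiableD; last exact/differentiableZl/differentiable_dot.
apply: differentiableD; last exact: differentiable_cst.
apply: differentiable_sum => i; apply: differentiableZl.
by apply: (@differentiable_comp _ _ _ _ F (fun N : 'rV_n => N 0 i)) => //;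
  exact: differentiable_coord.
Qed.

(** Both sides are the derivative of [contact F s]; this links the definition of [envelopes] to
    [dcontact]. *)
Lemma ldot_diff_lightlike (R : realType) (V : normedModType R) n (F : V -> 'rV[R]_n) x s Y :
  differentiable F x -> ldot s ('d (@lightlike R n \o F) x Y) = dcontact F s Y x.
Proof.
move=> dF; have [m hm] := ldot_dot s.
have h1 := is_derive_dot (is_derive_cst m x Y) (diff_is_derive Y (lightlike_differentiable dF)).
have h2 := is_derive_contact s Y dF.
rewrite hm -(near_derive_unique _ h1 h2) ?dot0l ?add0r //.
by near=> y; rewrite /contact hm.
Unshelve. all: by end_near. Qed.

Lemma dcontactE (R : realType) (V : normedModType R) n (F : V -> 'rV[R]_n) s Y x :
  dcontact F s Y x = dot (sphere_normal (F x) s) (dir_diff F Y x).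
Proof. by rewrite /dcontact /sphere_normal dotBl dotZl. Qed.

(** * Charts *)

Section Charts.
Variables (R : realType) (M : surface R).
Local Notation V := 'rV[R]_2.
Implicit Types (c d : chart R M) (p : M).

Lemma smooth_Ck (W : normedModType R) (F : M -> W) c k : smooth F -> atlas c ->
  Ck k (cmap c @` cdom c) (F \o cinv c).
Proof. by move=> sF ac; have := sF c ac k; rewrite setIT. Qed.

Lemma cinv_near c p (A : set M) : cdom c p -> (\forall q \near p, A q) ->
  \forall y \near cmap c p, A (cinv c y).
Proof.
move=> cp Ap; have Uy : (cmap c @` cdom c) (cmap c p) by exists p.
have := @cinv_continuous _ _ c; rewrite continuous_open_subspace; last exact: cimg_open.
by move=> /(_ (cmap c p)); rewrite inE => /(_ Uy); apply; rewrite /= cmapK.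
Qed.

Lemma cmap_near c p (A : set V) : cdom c p -> (\forall y \near cmap c p, A y) ->
  \forall q \near p, A (cmap c q).
Proof.
move=> cp Ap; have := @cmap_continuous _ _ c.
rewrite continuous_open_subspace; last exact: cdom_open.
by move=> /(_ p); rewrite inE => /(_ cp); apply.
Qed.

(** J is the differential of the transition map, by the chain rule. One J serves all maps, in
    particular f and f' simultaneously. *)
Lemma chart_change c d p : chart_at p c -> chart_at p d ->
  exists J : {linear V -> V}, forall (W : normedModType R) (F : M -> W),
    smooth F -> forall X, tmap F d p X = tmap F c p (J X).
Proof.
move=> [ac cp] [ad dp]; pose T := cmap c \o cinv d.
have dT : differentiable T (cmap d p).
  by have [h _] := atlas_smooth ad ac 1; apply: h; exists p.
exists ('d T (cmap d p)) => W F sF X; rewrite /tmap.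
have Tp : T (cmap d p) = cmap c p by rewrite /T /= cmapK.
have dFc : differentiable (F \o cinv c) (T (cmap d p)).
  by have [h _] := smooth_Ck 1 sF ac; apply: h; rewrite Tp; exists p.
have dFd : differentiable (F \o cinv d) (cmap d p).
  by have [h _] := smooth_Ck 1 sF ad; apply: h; exists p.
have e : \forall z \near cmap d p, (F \o cinv d) z = ((F \o cinv c) \o T) z.
  have h := cinv_near dp (open_nbhs_nbhs (conj (@cdom_open _ _ c) cp)).
  near=> z; rewrite /= /T /= cmapK //; near: z; exact: h.
apply: etrans (esym (deriveE X dFd)) _; apply: etrans (near_eq_derive X e) _.
rewrite -Tp; apply: etrans (deriveE X (differentiable_comp dT dFc)) _.
exact: (congr1 (@^~ X) (diff_comp dT dFc)).
Unshelve. all: by end_near. Qed.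

End Charts.

(** * Enveloped surfaces *)

Lemma mulmx2 (K : fieldType) (A B : 'M[K]_2) i j :
  (A *m B) i j = A i 0 * B 0 j + A i 1 * B 1 j.
Proof.
rewrite mxE big_ord_recl big_ord1; congr (_ + A i _ * B _ j); exact: val_inj.
Qed.

Lemma ord2_cases (i : 'I_2) : i = 0 \/ i = 1.
Proof. by case: i => -[|[|//]] lt; [left|right]; exact: val_inj. Qed.

Lemma matrix2P (K : fieldType) (A B : 'M[K]_2) : A 0 0 = B 0 0 -> A 0 1 = B 0 1 ->
  A 1 0 = B 1 0 -> A 1 1 = B 1 1 -> A = B.
Proof.
move=> h00 h01 h10 h11; apply/matrixP => i j.
by have [-> | ->] := ord2_cases i; have [-> | ->] := ord2_cases j.
Qed.

Lemma matrix2_eq0 (K : fieldType) (A : 'M[K]_2) a : (forall i j, A i j = a i j) ->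
  a 0 0 = 0 -> a 0 1 = 0 -> a 1 0 = 0 -> a 1 1 = 0 -> A = 0.
Proof. by move=> hA ? ? ? ?; apply: matrix2P; rewrite hA mxE. Qed.

(** Replacing the inverse of G by its adjugate [Ga] clears the denominators; the conclusion is the
    entry (1, 2) in the form used by [ribaucour_dichotomy]. *)
Lemma comm_shape_entry (K : fieldType) (L L' G : 'M[K]_2) (l l' g : 'I_2 -> 'I_2 -> K) :
  (forall i j, L i j = l i j) -> (forall i j, L' i j = l' i j) ->
  (forall i j, G i j = g i j) -> g 1 0 = g 0 1 -> g 0 0 * g 1 1 - g 0 1 ^+ 2 != 0 ->
  comm_mx (L *m invmx G) (L' *m invmx G) ->
  let p11 := l 0 0 * g 1 1 - l 0 1 * g 0 1 in
  let p12 := l 0 1 * g 0 0 - l 0 0 * g 0 1 in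
  let p22 := l 1 1 * g 0 0 - l 1 0 * g 0 1 in
  let q11 := l' 0 0 * g 1 1 - l' 0 1 * g 0 1 in
  let q12 := l' 0 1 * g 0 0 - l' 0 0 * g 0 1 in
  let q22 := l' 1 1 * g 0 0 - l' 1 0 * g 0 1 in
  p11 * q12 + p12 * q22 = q11 * p12 + q12 * p22.
Proof.
move=> hL hL' hG; rewrite -!hG -!hL -!hL'.
set D := _ - _; move=> Gs D0 h.
pose Ga : 'M[K]_2 := \matrix_(i, j)
  if i == j then (if i == 0 then G 1 1 else G 0 0) else - G 0 1.
have GGa : G *m Ga = D%:M.
  apply: matrix2P; rewrite !mulmx2 !mxE /= /D ?Gs ?mulr1n ?mulr0n; ring.
have Gu : G \in unitmx.
  have : G *m (D^-1 *: Ga) = 1%:M by rewrite -scalemxAr GGa scale_scalar_mx mulVf.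
  by case/mulmx1_unit.
have hGa : Ga = D *: invmx G.
  by rewrite -[Ga](mulKmx Gu) GGa mul_mx_scalar.
have {h} h : (L *m Ga) *m (L' *m Ga) = (L' *m Ga) *m (L *m Ga).
  by rewrite hGa -!scalemxAr -!scalemxAl h.
have := congr1 (fun A : 'M[K]_2 => A 0 1) h; rewrite !mulmx2 !mxE /= => e /=.
move/eqP: e; rewrite -subr_eq0 => /eqP e; apply/eqP; rewrite -subr_eq0 -[X in _ == X]e.
by apply/eqP; ring.
Qed.

Lemma conj_relation (K : fieldType) (A : algType K) (a b : A) (x z : K) : x != 0 ->
  a * a = (- x)%:A -> a * b + b * a = (- (2 * z))%:A ->
  - (b - (2 * z / x) *: a) * a = a * b.
Proof.
move=> x0 aa ab; rewrite (_ : a * b = (- (2 * z))%:A - b * a); last by rewrite -ab addrK.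
by rewrite opprB mulrBl -scalerAl aa scalerA mulrN divfK.
Qed.

(** Conjugation by g is minus the reflection, so the N' in [ribaucour] is - rho N; this is the
    source of the sign in [shape_commute]. *)
Lemma cvec_conj_refl (R : realFieldType) n (g v : 'rV[R]_n) : g != 0 ->
  cvec (- refl g v) = cvec g * cvec v * (cvec g)^-1.
Proof.
move=> g0; apply: (canRL (mulrK (cvec_unit g0))).
rewrite -scaleN1r cvecZ scaleN1r /refl cvecD -scaleNr cvecZ scaleNr.
apply: conj_relation; [by rewrite dot_eq0|exact: cvecM|].
by rewrite mulr_natl; exact: clifford_relation.
Qed.

Section EnvelopedSurfaces.
Variables (R : realType) (n : nat) (M : surface R) (f f' : M -> 'rV[R]_n).
Variable S : M -> {vspace lorentz R n}.
Hypothesis f_immersion : immersion f.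
Hypothesis f'_immersion : immersion f'.
Hypothesis g_neq0 : forall p, f' p - f p != 0.
Hypothesis S_congruence : sphere_congruence S.
Hypothesis f_envelopes : envelopes f S.
Hypothesis f'_envelopes : envelopes f' S.
Local Notation V := 'rV[R]_2.
Implicit Types (c d : chart R M) (p q : M) (s : lorentz R n).

Local Notation u1 := (delta_mx 0 0 : V).
Local Notation u2 := (delta_mx 0 1 : V).
Local Notation "F '\at' c" := (F \o cinv c) (at level 40).

Lemma span_delta (v : V) : exists a b, v = a *: u1 + b *: u2.
Proof.
exists (v 0 0), (v 0 1); rewrite {1}[v]row_sum_delta big_ord_recl big_ord1.
by congr (_ + _ *: delta_mx _ _); [congr (v 0 _)|]; exact: val_inj.
Qed.

Section InChart.
Variable c : chart R M.
Hypothesis ac : atlas c.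
Let U : set V := cmap c @` cdom c.

Lemma chart_img x : U x -> exists2 q, cdom c q & x = cmap c q.
Proof. by case=> q cq <-; exists q. Qed.

Lemma chart_point (F : M -> 'rV[R]_n) q : cdom c q -> (F \at c) (cmap c q) = F q.
Proof. by move=> cq; rewrite /= cmapK. Qed.

Lemma chart_gap x : U x -> (f' \at c) x - (f \at c) x != 0.
Proof. by case/chart_img => q cq ->; rewrite !chart_point. Qed.

Lemma chart_C2 (F : M -> 'rV[R]_n) : immersion F -> Ck 2 U (F \at c).
Proof. by case=> sF _; exact: smooth_Ck. Qed.

Lemma chart_free (F : M -> 'rV[R]_n) x a b : immersion F -> U x ->
  a *: dir_diff (F \at c) u1 x + b *: dir_diff (F \at c) u2 x = 0 -> a = 0 /\ b = 0.
Proof.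
case=> _ iF /chart_img[q cq ->] h.
have /(iF q c (conj ac cq)) : tmap F c q (a *: u1 + b *: u2) = tmap F c q 0.
  by rewrite /tmap linearD !linearZ linear0.
move/rowP => e; have := e 0; have := e 1; rewrite !mxE /= !mulr0 !mulr1 addr0 add0r.
by [].
Qed.

Lemma chart_contact (F : M -> 'rV[R]_n) q s : immersion F -> envelopes F S -> cdom c q ->
  s \in S q -> contact (F \at c) s (cmap c q) = 0.
Proof.
by move=> _ eF cq /eF[h _]; rewrite /contact chart_point.
Qed.

Lemma chart_dcontact (F : M -> 'rV[R]_n) q s Y : immersion F -> envelopes F S -> cdom c q ->
  s \in S q -> dcontact (F \at c) s Y (cmap c q) = 0.
Proof.
move=> iF eF cq /eF[_ /(_ c Y (conj ac cq))].
rewrite /tmap; have := @ldot_diff_lightlike _ _ _ (F \at c) (cmap c q) s Y.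
rewrite -compA => h; rewrite h //.
have [dF _] := smooth_Ck 1 iF.1 ac; apply: dF; by exists q.
Qed.

Lemma chart_sphere_normal (F : M -> 'rV[R]_n) q s Y : immersion F -> envelopes F S ->
  cdom c q -> s \in S q -> dot (sphere_normal (F q) s) (dir_diff (F \at c) Y (cmap c q)) = 0.
Proof.
move=> iF eF cq sS; have := chart_dcontact Y iF eF cq sS.
by rewrite dcontactE chart_point.
Qed.

Lemma chart_normal_sphere (F : M -> 'rV[R]_n) q N : immersion F -> envelopes F S ->
  cdom c q -> dot N (dir_diff (F \at c) u1 (cmap c q)) = 0 ->
  dot N (dir_diff (F \at c) u2 (cmap c q)) = 0 -> exists2 s, s \in S q & sphere_normal (F q) s = N.
Proof.
move=> iF eF cq N1 N2; have [dimS posS _] := S_congruence.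
apply: (@sphere_normal_surj _ _ _ _ (dir_diff (F \at c) u1 (cmap c q))
  (dir_diff (F \at c) u2 (cmap c q)) _ (dimS q) (posS q)) => //.
- by move=> s /eF[].
- by move=> s; exact: chart_sphere_normal.
- by move=> s; exact: chart_sphere_normal.
have [|_ _ G0] := @gram_gt0 _ _ (dir_diff (F \at c) u1 (cmap c q)) (dir_diff (F \at c) u2 (cmap c q)).
  by move=> a b; apply: chart_free => //; exists q.
by rewrite gt_eqF.
Qed.

Lemma sphere_normal_swap q s : s \in S q ->
  sphere_normal (f' q) s = refl (f' q - f q) (sphere_normal (f q) s).
Proof.
move=> sS; apply: sphere_normal_refl.
- by have := g_neq0 q; rewrite subr_eq0 eq_sym.
- by have [] := f_envelopes sS.
- by have [] := f'_envelopes sS.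
Qed.

(** Each normal of f is the normal of some sphere in S(q), whose normal at f' is the reflected one.
    This supplies the assumption [normal_refl] in a chart. *)
Lemma chart_normal_refl x N Y : U x -> dot N (dir_diff (f \at c) u1 x) = 0 ->
  dot N (dir_diff (f \at c) u2 x) = 0 ->
  dot (refl ((f' \at c) x - (f \at c) x) N) (dir_diff (f' \at c) Y x) = 0.
Proof.
case/chart_img => q cq -> N1 N2; rewrite !chart_point //.
have [s sS <-] := chart_normal_sphere f_immersion f_envelopes cq N1 N2.
by rewrite -sphere_normal_swap //; exact: chart_sphere_normal.
Qed.

End InChart.

(** * Points where B is scalar, and the sign of det B across charts *)

Local Notation mdet c p := (mixed_det u1 u2 (f \at c) (f' \at c) (cmap c p)).

Lemma dir_diff_linear (F : V -> 'rV[R]_n) a b Y Z x :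
  dir_diff F (a *: Y + b *: Z) x = a *: dir_diff F Y x + b *: dir_diff F Z x.
Proof. by rewrite /dir_diff linearD !linearZ. Qed.

(** All charts are quantified over to make this a property of p; by [scalar_point_chart] one chart
    suffices to check it. *)
Definition scalar_point p m := forall c, chart_at p c ->
  forall Y, refl (f' p - f p) (tmap f' c p Y) = m *: tmap f c p Y.

Lemma scalar_point_chart c p m : chart_at p c ->
  (forall Y, refl (f' p - f p) (tmap f' c p Y) = m *: tmap f c p Y) -> scalar_point p m.
Proof.
move=> cp h d dp Y; have [J hJ] := chart_change cp dp.
by rewrite !hJ //; [exact: f_immersion.1|exact: f'_immersion.1].
Qed.

Lemma scalar_point_at c p m : chart_at p c -> scalar_point p m ->
  scalar_at u1 u2 (f \at c) (f' \at c) (cmap c p) /\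
  coef1 u1 u2 (f \at c) (f' \at c) u1 (cmap c p) = m.
Proof.
move=> [ac cp] h; have Ux : (cmap c @` cdom c) (cmap c p) by exists p.
have free x a b := chart_free ac f_immersion (x := x) (a := a) (b := b).
have ht Y := refl_tangent free (chart_normal_refl ac) Y Ux.
have hY Y : refl ((f' \at c) (cmap c p) - (f \at c) (cmap c p)) (dir_diff (f' \at c) Y (cmap c p))
   = m *: dir_diff (f \at c) Y (cmap c p).
  by have := h c (conj ac cp) Y; rewrite !chart_point.
have := free (cmap c p) (coef1 u1 u2 (f \at c) (f' \at c) u1 (cmap c p) - m)
  (coef2 u1 u2 (f \at c) (f' \at c) u1 (cmap c p)) Ux.
rewrite scalerBl addrAC -ht hY subrr => /(_ erefl)[/eqP].
rewrite subr_eq0 => /eqP e11 e12.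
have := free (cmap c p) (coef1 u1 u2 (f \at c) (f' \at c) u2 (cmap c p))
  (coef2 u1 u2 (f \at c) (f' \at c) u2 (cmap c p) - m) Ux.
rewrite scalerBl addrA -ht hY subrr => /(_ erefl)[e21 /eqP].
rewrite subr_eq0 => /eqP e22.
by split=> //; split=> //; rewrite e11 e22.
Qed.

Lemma scalar_at_point c p : chart_at p c ->
  scalar_at u1 u2 (f \at c) (f' \at c) (cmap c p) ->
  scalar_point p (coef1 u1 u2 (f \at c) (f' \at c) u1 (cmap c p)).
Proof.
move=> [ac cp] h; have Ux : (cmap c @` cdom c) (cmap c p) by exists p.
have free x a b := chart_free ac f_immersion (x := x) (a := a) (b := b).
have [] := refl_scalar free (chart_normal_refl ac) Ux h.
rewrite !chart_point // => h1 h2; apply: (scalar_point_chart (conj ac cp)) => Y.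
have [a [b ->]] := span_delta Y.
rewrite -[tmap f' c p _]/(dir_diff _ _ _) -[tmap f c p _]/(dir_diff _ _ _).
rewrite !dir_diff_linear reflD !reflZ.
by rewrite h1 h2 scalerDr !scalerA ![_ * coef1 _ _ _ _ _ _]mulrC.
Qed.

Hypothesis S_conformal : conformally_equivalent f f'.

Lemma chart_conformal c p : chart_at p c -> exists2 l : R, 0 < l & forall Y Z,
  dot (dir_diff (f' \at c) Y (cmap c p)) (dir_diff (f' \at c) Z (cmap c p)) =
  l * dot (dir_diff (f \at c) Y (cmap c p)) (dir_diff (f \at c) Z (cmap c p)).
Proof.
move=> cp; have [lam [_ lam0 h]] := S_conformal; exists (lam p) => // Y Z.
exact: h.
Qed.

Lemma bdet_chart_neq0 c p : chart_at p c ->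
  bdet u1 u2 (f \at c) (f' \at c) (cmap c p) != 0.
Proof.
move=> cp; have [l l0 hl] := chart_conformal cp; case: cp => ac cp.
have Ux : (cmap c @` cdom c) (cmap c p) by exists p.
have free x a b := chart_free ac f_immersion (x := x) (a := a) (b := b).
exact: (bdet_neq0 free (chart_gap (c := c)) (chart_normal_refl ac) Ux l0 hl).
Qed.

Lemma mdet_gt0 c p : chart_at p c ->
  (0 < mdet c p) = (0 < bdet u1 u2 (f \at c) (f' \at c) (cmap c p)).
Proof.
move=> [ac cp]; have Ux : (cmap c @` cdom c) (cmap c p) by exists p.
have free x a b := chart_free ac f_immersion (x := x) (a := a) (b := b).
exact: (mixed_det_gt0 free (chart_normal_refl ac) Ux).
Qed.

Lemma mdet_neq0 c p : chart_at p c -> mdet c p != 0.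
Proof.
move=> cp; have b0 := bdet_chart_neq0 cp; case: cp => ac cp.
have Ux : (cmap c @` cdom c) (cmap c p) by exists p.
have free x a b := chart_free ac f_immersion (x := x) (a := a) (b := b).
rewrite (mixed_detE free (chart_normal_refl ac) Ux) mulf_neq0 //.
by have [_ _ G0] := gram_pos free Ux; rewrite gt_eqF.
Qed.

(** [mixed] is bilinear in the tangent vectors, so its determinant is multiplied by (det J)^2;
    strictness comes from [mdet_neq0]. *)
Lemma mdet_chart_gt0 c d p : chart_at p c -> chart_at p d -> 0 < mdet c p -> 0 < mdet d p.
Proof.
move=> cp dp mc; have [J hJ] := chart_change cp dp.
have mE Y Z : mixed (f \at d) (f' \at d) Y Z (cmap d p) =
    mixed (f \at c) (f' \at c) (J Y) (J Z) (cmap c p).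
  have e1 := hJ _ f f_immersion.1 Z; have e2 := hJ _ f' f'_immersion.1 Y.
  rewrite /mixed -[dir_diff (f' \at d) _ _]/(tmap f' d p Y).
  rewrite -[dir_diff (f \at d) _ _]/(tmap f d p Z).
  rewrite e1 e2 (chart_point f cp.2) (chart_point f dp.2).
  by rewrite (chart_point f' cp.2) (chart_point f' dp.2).
have mL a b a' b' : mixed (f \at c) (f' \at c) (a *: u1 + b *: u2) (a' *: u1 + b' *: u2) (cmap c p)
   = a * a' * mixed (f \at c) (f' \at c) u1 u1 (cmap c p)
   + a * b' * mixed (f \at c) (f' \at c) u1 u2 (cmap c p)
   + b * a' * mixed (f \at c) (f' \at c) u2 u1 (cmap c p)
   + b * b' * mixed (f \at c) (f' \at c) u2 u2 (cmap c p).
  rewrite /mixed !dir_diff_linear; move: ((f' \at c) (cmap c p) - (f \at c) (cmap c p)) => gx.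
  move: (dir_diff (f \at c) u1 _) (dir_diff (f \at c) u2 _).
  move: (dir_diff (f' \at c) u1 _) (dir_diff (f' \at c) u2 _).
  by move=> w1 w2 w3 w4; rewrite !dotDl !dotDr !dotZl !dotZr; ring.
have [a [b e1]] := span_delta (J u1); have [a' [b' e2]] := span_delta (J u2).
have e : mdet d p = (a * b' - b * a') ^+ 2 * mdet c p.
  by rewrite /mixed_det !mE e1 e2 !mL; ring.
by rewrite lt_neqAle eq_sym mdet_neq0 //= e mulr_ge0 ?sqr_ge0 ?ltW.
Qed.

Lemma scalar_point_mdet c p m : chart_at p c -> scalar_point p m -> 0 < mdet c p.
Proof.
move=> cp /(scalar_point_at cp)[[h1 h2 h3] _]; rewrite mdet_gt0 // /bdet h1 h3 mul0r subr0.
rewrite lt_neqAle -expr2 sqr_ge0 andbT eq_sym sqrf_eq0.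
by have := bdet_chart_neq0 cp; rewrite /bdet h1 h3 mul0r subr0 mulf_eq0 orbb.
Qed.

(** * The Ribaucour condition on Hessians, and umbilic points *)

Hypothesis S_ribaucour : ribaucour f f'.

Definition hess (F : M -> 'rV[R]_n) c s p : 'M[R]_2 :=
  form_mx (fun X Y => ddcontact (F \at c) s X Y (cmap c p)).

Lemma hessE (F : M -> 'rV[R]_n) c s p i j : hess F c s p i j =
  ddcontact (F \at c) s (delta_mx 0 i) (delta_mx 0 j) (cmap c p).
Proof. by rewrite mxE. Qed.

Lemma form_metricE (F : M -> 'rV[R]_n) c p i j : form_mx (induced_metric F c p) i j =
  dot (dir_diff (F \at c) (delta_mx 0 i) (cmap c p)) (dir_diff (F \at c) (delta_mx 0 j) (cmap c p)).
Proof. by rewrite mxE. Qed.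

Lemma form_second_form (F : M -> 'rV[R]_n) c p s : cdom c p ->
  form_mx (second_form F c p (sphere_normal (F p) s)) =
  hess F c s p + v0_coord s *: form_mx (induced_metric F c p).
Proof.
move=> cp; apply/matrixP => i j; rewrite !mxE /ddcontact chart_point //.
set X := delta_mx 0 i; set Y := delta_mx 0 j.
rewrite /second_form /induced_metric.
rewrite -[tmap2 F c p X Y]/(dir_diff2 (F \at c) X Y (cmap c p)).
rewrite -[tmap F c p X]/(dir_diff (F \at c) X (cmap c p)).
rewrite -[tmap F c p Y]/(dir_diff (F \at c) Y (cmap c p)).
by rewrite subrK; exact: dotC.
Qed.

Lemma form_second_formN (F : M -> 'rV[R]_n) c p N :
  form_mx (second_form F c p (- N)) = - form_mx (second_form F c p N).
Proof. by apply/matrixP => i j; rewrite !mxE /second_form dotNr. Qed.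

Lemma metric_conformal c p : chart_at p c -> exists2 l : R, 0 < l &
  form_mx (induced_metric f' c p) = l *: form_mx (induced_metric f c p).
Proof.
move=> cp; have [l l0 hl] := chart_conformal cp; exists l => //.
by apply/matrixP => i j; rewrite !mxE; exact: hl.
Qed.

Lemma sphere_normal_normal (F : M -> 'rV[R]_n) p s : immersion F -> envelopes F S ->
  s \in S p -> normal F p (sphere_normal (F p) s).
Proof. by move=> iF eF sS c [ac cp] X; exact: chart_sphere_normal. Qed.

Lemma hess_commute c p s : chart_at p c -> s \in S p ->
  comm_mx (hess f c s p *m invmx (form_mx (induced_metric f c p)))
          (hess f' c s p *m invmx (form_mx (induced_metric f c p))).
Proof.
move=> cp sS; have [l l0 hl] := metric_conformal cp.
have l_neq0 : l != 0 by rewrite gt_eqF.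
have cN : cvec (- sphere_normal (f' p) s) = cvec (f' p - f p) *
    cvec (sphere_normal (f p) s) * (cvec (f' p - f p))^-1.
  by rewrite -cvec_conj_refl // -sphere_normal_swap.
apply: (shape_commute (metric_unit f_immersion cp) l_neq0 hl
  (form_second_form f s cp.2) (form_second_form f' s cp.2)).
rewrite -form_second_formN.
exact: (S_ribaucour cp (sphere_normal_normal f_immersion f_envelopes sS) cN).
Qed.

(** [bdet_gt0_dichotomy] concerns a single s; deciding [scalar_at] beforehand makes the Hessians
    vanish for all s at once. *)
Lemma chart_trichotomy c p : chart_at p c -> 0 < mdet c p ->
  scalar_at u1 u2 (f \at c) (f' \at c) (cmap c p) \/
  forall s, s \in S p -> hess f c s p = 0 /\ hess f' c s p = 0.
Proof.
move=> cp md0; case: (pselect (scalar_at u1 u2 (f \at c) (f' \at c) (cmap c p))).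
  by left.
move=> nsc; right => s sS; have [l l0 hl] := chart_conformal cp.
have := cp => -[ac cdp]; have Ux : (cmap c @` cdom c) (cmap c p) by exists p.
have free x a b := chart_free ac f_immersion (x := x) (a := a) (b := b).
have b0 : 0 < bdet u1 u2 (f \at c) (f' \at c) (cmap c p) by rewrite -mdet_gt0.
have [_ _ G0] := gram_pos free Ux.
have h := comm_shape_entry (hessE f c s p) (hessE f' c s p) (form_metricE f c p)
  (dotC _ _) (lt0r_neq0 G0) (hess_commute cp sS).
have [|[[h00 h01 h10 h11] [k00 k01 k10 k11]]] := bdet_gt0_dichotomy (cimg_open (c := c))
  (chart_C2 ac f_immersion)
  (chart_C2 ac f'_immersion) free (chart_gap (c := c)) (chart_normal_refl ac) Ux l0 hl b0
  (chart_contact f_immersion f_envelopes cdp sS) (chart_contact f'_immersion f'_envelopes cdp sS)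
  (fun Y => chart_dcontact ac Y f_immersion f_envelopes cdp sS)
  (fun Y => chart_dcontact ac Y f'_immersion f'_envelopes cdp sS)
  h.
  by move=> sc; case: (nsc sc).
split; first exact: (matrix2_eq0 (hessE f c s p) h00 h01 h10 h11).
exact: (matrix2_eq0 (hessE f' c s p) k00 k01 k10 k11).
Qed.

(** Every normal is that of a sphere in S(p), and along it the second form reduces to [v0_coord s]
    times the metric. *)
Lemma hess0_umbilic (F : M -> 'rV[R]_n) p : immersion F -> envelopes F S ->
  (forall c s, chart_at p c -> s \in S p -> hess F c s p = 0) -> umbilic F p.
Proof.
move=> iF eF h c N cp nN.
have [s sS <-] : exists2 s, s \in S p & sphere_normal (F p) s = N.
  apply: (chart_normal_sphere cp.1 iF eF cp.2); exact: (nN c cp).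
rewrite /shape_op form_second_form ?(h _ _ cp sS) ?add0r; last exact: cp.2.
rewrite -scalemxAl mulmxV ?metric_unit // scalemx1.
exact: scalar_mx_is_scalar.
Qed.

Hypothesis no_common_umbilic : forall p, ~ (umbilic f p /\ umbilic f' p).

(** Positivity of [mdet] passes to all charts. If B were not scalar, the Hessians would vanish in
    each of them, and p would be a common umbilic. *)
Lemma mdet_gt0_scalar c p : chart_at p c -> 0 < mdet c p -> exists m, scalar_point p m.
Proof.
move=> cp md0; apply: contrapT => no_scalar.
have h d : chart_at p d -> forall s, s \in S p -> hess f d s p = 0 /\ hess f' d s p = 0.
  move=> dp; have [sc|//] := chart_trichotomy dp (mdet_chart_gt0 cp dp md0).
  by case: no_scalar; exists (coef1 u1 u2 (f \at d) (f' \at d) u1 (cmap d p));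
    exact: scalar_at_point.
by apply: (no_common_umbilic (p := p)); split; apply: hess0_umbilic => // d s dp sS;
  have [] := h d dp s sS.
Qed.

Lemma mdet_lt0_wedge c p (X Y : V) : chart_at p c -> mdet c p < 0 ->
  let g := cvec (f' p - f p) in
  wedge (fun Z => cvec (tmap f c p Z))
        (fun Z => g^-1 * cvec (tmap f' c p Z) * g^-1) X Y = 0.
Proof.
move=> cp md0; have [l l0 hl] := chart_conformal cp.
have b0 : bdet u1 u2 (f \at c) (f' \at c) (cmap c p) < 0.
  have : ~~ (0 < mdet c p) by rewrite -leNgt ltW.
  by rewrite (mdet_gt0 cp) -leNgt le_eqVlt (negbTE (bdet_chart_neq0 cp)).
have := cp => -[ac cdp]; have Ux : (cmap c @` cdom c) (cmap c p) by exists p.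
have free x a b := chart_free ac f_immersion (x := x) (a := a) (b := b).
have key := bdet_lt0_comm free (chart_gap (c := c)) (chart_normal_refl ac) Ux l0 hl b0.
rewrite /wedge !cvec_sandwich // -!scalerAr -scalerBr.
have [a [b eX]] := span_delta X; have [a' [b' eY]] := span_delta Y.
have dX (F : M -> 'rV[R]_n) : tmap F c p X = a *: dir_diff (F \at c) u1 (cmap c p)
    + b *: dir_diff (F \at c) u2 (cmap c p) by rewrite -dir_diff_linear -eX.
have dY (F : M -> 'rV[R]_n) : tmap F c p Y = a' *: dir_diff (F \at c) u1 (cmap c p)
    + b' *: dir_diff (F \at c) u2 (cmap c p) by rewrite -dir_diff_linear -eY.
have gE : f' p - f p = (f' \at c) (cmap c p) - (f \at c) (cmap c p).
  by rewrite !chart_point.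
rewrite (dX f) (dX f') (dY f) (dY f') gE (key a b a' b').
by rewrite subrr scaler0.
Qed.

(** * The line spanned by w = phi' - m phi, which [weight] pairs with s, and its constancy *)

Definition weight p m s := ldot s (lightlike (f' p)) - m * ldot s (lightlike (f p)).

(** det B > 0 is an open condition, so B is scalar around p and [omega_line] applies. *)
Lemma scalar_point_near p m : scalar_point p m ->
  \forall q \near p, exists m' k, [/\ k != 0, scalar_point q m' &
    forall s, weight q m' s = k * weight p m s].
Proof.
move=> sc; have [c ac cp] := @atlas_cover _ M p.
have Ux : (cmap c @` cdom c) (cmap c p) by exists p.
have free x a b := chart_free ac f_immersion (x := x) (a := a) (b := b).
have m0 := scalar_point_mdet (conj ac cp) sc.
have Uo : open (cmap c @` cdom c) := cimg_open (c := c).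
have scal_at y : (cmap c @` cdom c) y -> 0 < mixed_det u1 u2 (f \at c) (f' \at c) y ->
    scalar_at u1 u2 (f \at c) (f' \at c) y.
  move=> /chart_img[q cq ->] /(mdet_gt0_scalar (conj ac cq))[m' scm'].
  by have [] := scalar_point_at (conj ac cq) scm'.
have mcont := mixed_det_continuous (u1 := u1) (u2 := u2) (chart_C2 ac f_immersion)
  (chart_C2 ac f'_immersion) (chart_gap (c := c)) Ux.
have m_near : \forall y \near cmap c p, 0 < mixed_det u1 u2 (f \at c) (f' \at c) y.
  exact: (mcont _ (open_nbhs_nbhs (conj (@open_gt _ 0) m0))).
have U_near : \forall y \near cmap c p, (cmap c @` cdom c) y by exact: open_nbhs_nbhs.
have sc_near : \forall y \near cmap c p, scalar_at u1 u2 (f \at c) (f' \at c) y.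
  by near=> y; apply: scal_at; near: y.
have w_near := omega_line Uo (chart_C2 ac f_immersion) (chart_C2 ac f'_immersion) free
  (chart_gap (c := c)) (chart_normal_refl ac) span_delta Ux sc_near.
have q_near : \forall q \near p, cdom c q by exact: open_nbhs_nbhs (conj (@cdom_open _ _ c) cp).
have sq_near := cmap_near cp sc_near.
have wq_near := cmap_near cp w_near.
near=> q.
have cq : cdom c q by near: q.
have scq : scalar_at u1 u2 (f \at c) (f' \at c) (cmap c q) by near: q.
have [k k0 wk] : exists2 k, k != 0 & forall s,
  omega u1 u2 (f \at c) (f' \at c) s (cmap c q)
    = k * omega u1 u2 (f \at c) (f' \at c) s (cmap c p).
  by near: q.
exists (coef1 u1 u2 (f \at c) (f' \at c) u1 (cmap c q)), k; split=> //.
  exact: scalar_at_point.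
move=> s; have := wk s; rewrite /omega /contact !chart_point //.
by have [_ ->] := scalar_point_at (conj ac cp) sc.
Unshelve. all: by end_near. Qed.

(** Here det B < 0, again an open condition, whereas scalar points have det B > 0. *)
Lemma not_scalar_point_near p : ~ (exists m, scalar_point p m) ->
  \forall q \near p, ~ (exists m, scalar_point q m).
Proof.
move=> nsc; have [c ac cp] := @atlas_cover _ M p.
have Ux : (cmap c @` cdom c) (cmap c p) by exists p.
have m0 : mdet c p < 0.
  rewrite lt_neqAle (mdet_neq0 (conj ac cp)) leNgt; apply/negP => m0.
  exact: nsc (mdet_gt0_scalar (conj ac cp) m0).
have mcont := mixed_det_continuous (u1 := u1) (u2 := u2) (chart_C2 ac f_immersion)
  (chart_C2 ac f'_immersion) (chart_gap (c := c)) Ux.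
have m_near : \forall y \near cmap c p, mixed_det u1 u2 (f \at c) (f' \at c) y < 0.
  exact: (mcont _ (open_nbhs_nbhs (conj (@open_lt _ 0) m0))).
have q_near : \forall q \near p, cdom c q by exact: open_nbhs_nbhs (conj (@cdom_open _ _ c) cp).
have mq_near := cmap_near cp m_near.
near=> q; move=> [m' sc']; have cq : cdom c q by near: q.
have := scalar_point_mdet (conj ac cq) sc'; apply/negP; rewrite -leNgt ltW //.
by near: q.
Unshelve. all: by end_near. Qed.

Lemma scalar_point_unique p m m' : scalar_point p m -> scalar_point p m' -> m = m'.
Proof.
have [c ac cp] := @atlas_cover _ M p.
by move=> /(scalar_point_at (conj ac cp))[_ <-] /(scalar_point_at (conj ac cp))[_ <-].
Qed.

Hypothesis M_connected : connected [set: M].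

(** The set A of points carrying the same line as p is open and closed: around a point outside A,
    either no point is scalar or the line is locally constant. *)
Lemma scalar_point_line p m : scalar_point p m -> forall q,
  exists m' k, [/\ k != 0, scalar_point q m' & forall s, weight q m' s = k * weight p m s].
Proof.
move=> sc; pose A : set M := [set q | exists m' k, [/\ k != 0, scalar_point q m' &
  forall s, weight q m' s = k * weight p m s]].
have Ao : open A.
  rewrite openE => q [m' [k [k0 sc' wk]]]; rewrite /interior /=.
  have := scalar_point_near sc'; apply: filterS => r [m2 [k2 [k20 sc2 wk2]]].
  exists m2, (k2 * k); split=> //; first by rewrite mulf_neq0.
  by move=> s; rewrite wk2 wk mulrA.
have Ac : closed A.
  rewrite -[A]setCK; apply: open_closedC; rewrite openE => q nAq; rewrite /interior /=.
  have [[m' sc']|nsc] := pselect (exists m', scalar_point q m'); last first.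
    have := not_scalar_point_near nsc; apply: filterS => r nr [m2 [k2 [_ sc2 _]]].
    by apply: nr; exists m2.
  have := scalar_point_near sc'; apply: filterS => r [m2 [k2 [k20 sc2 wk2]]].
  (* A neighbour r in A has factor [k3] relative to p and [k2] relative to q, hence q has factor k3
     / k2 relative to p. *)
  move=> [m3 [k3 [k30 sc3 wk3]]]; apply: nAq; exists m', (k3 / k2); split=> //.
    by rewrite mulf_neq0 ?invr_eq0.
  move=> s; have := wk2 s; rewrite (scalar_point_unique sc2 sc3) wk3 => e.
  by rewrite mulrAC e mulrAC mulfV // mul1r.
have AT : A = setT.
  apply: M_connected; [|by exists A; rewrite ?setTI|by exists A; rewrite ?setTI].
  by exists p, m, 1; split=> // s; rewrite mul1r.
by move=> q; have : A q by rewrite AT.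
Qed.

Hypothesis S_full : full S.

Lemma weight_linear p m : linear (weight p m : lorentz R n -> R^o).
Proof.
move=> a s t; rewrite /weight !ldotDl !ldotZl -[a *: _]/(a * _); ring.
Qed.

HB.instance Definition _ p m := GRing.isLinear.Build R (lorentz R n) R^o *:%R
  (weight p m : lorentz R n -> R^o) (@weight_linear p m).

Lemma weight_lightlike p m : weight p m (lightlike (f p)) != 0.
Proof.
rewrite /weight !ldot_lightlike2 subrr dot0l !mulr0 subr0.
by rewrite mulf_neq0 ?oppr_eq0 ?invr_eq0 ?pnatr_eq0 ?dot_eq0.
Qed.

(** The hyperplane orthogonal to w contains every S(q), since S(q) is orthogonal to phi and phi' at
    q and w spans the same line everywhere. That w is nonzero is seen by pairing it with phi(p). *)
Lemma not_scalar_point p m : ~ scalar_point p m.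
Proof.
move=> sc; apply: S_full; exists (lker (linfun (weight p m : lorentz R n -> R^o))).
split; last first.
  move=> q; apply/subvP => s sS; rewrite memv_ker lfunE /=.
  have [m' [k [k0 _ wk]]] := scalar_point_line sc q.
  have : weight q m' s = 0.
    by rewrite /weight (f_envelopes sS).1 (f'_envelopes sS).1 mulr0 subr0.
  by rewrite wk => /eqP; rewrite mulf_eq0 (negbTE k0).
have := limg_ker_dim (linfun (weight p m : lorentz R n -> R^o)) fullv.
have -> : \dim (limg (linfun (weight p m : lorentz R n -> R^o))) = 1%N.
  apply/eqP; rewrite eqn_leq; apply/andP; split.
    by apply: leq_trans (dimvS (subvf _)) _; rewrite dimvf.
  rewrite lt0n dimv_eq0; apply/eqP => l0.
  have : weight p m (lightlike (f p)) \in limg (linfun (weight p m : lorentz R n -> R^o)).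
    by apply/memv_imgP; exists (lightlike (f p)); [exact: memvf|rewrite lfunE].
  by rewrite l0 memv0 (negbTE (weight_lightlike p m)).
have dimL : \dim {:lorentz R n} = (n.+1 + 1)%N.
  by rewrite dimvf /dim /= mul1n addnA !addn1.
by rewrite capfv dimL; exact: addIn.
Qed.

(** det B is nowhere zero, and where it is positive B would be scalar, which fullness excludes; so
    it is negative. *)
Lemma wedge_eq0 c p (X Y : V) : chart_at p c ->
  let g := cvec (f' p - f p) in
  wedge (fun Z => cvec (tmap f c p Z))
        (fun Z => g^-1 * cvec (tmap f' c p Z) * g^-1) X Y = 0.
Proof.
move=> cp; apply: mdet_lt0_wedge => //.
rewrite lt_neqAle mdet_neq0 // leNgt; apply/negP => m0.
by have [m] := mdet_gt0_scalar cp m0; exact: not_scalar_point.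
Qed.

End EnvelopedSurfaces.

Theorem proposition2p9 (R : realType) (n : nat) (M : surface R)
    (f f' : M -> 'rV[R]_n) (S : M -> {vspace lorentz R n})
    (M_connected : connected [set: M])
    (f_immersion : immersion f) (f'_immersion : immersion f')
    (g_neq0 : forall p : M, f' p - f p != 0)
    (S_congruence : sphere_congruence S)
    (f_envelopes : envelopes f S) (f'_envelopes : envelopes f' S)
    (S_full : full S)
    (S_conformal : conformally_equivalent f f')
    (S_ribaucour : ribaucour f f')
    (no_common_umbilic : forall p : M, ~ (umbilic f p /\ umbilic f' p)) :
  forall (p : M) (c : chart R M), chart_at p c ->
  forall X Y : 'rV[R]_2,
    let g := cvec (f' p - f p) in
    wedge (fun Z => cvec (tmap f c p Z))
          (fun Z => g^-1 * cvec (tmap f' c p Z) * g^-1) X Y = 0.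
Proof.
move=> p c cp X Y.
exact: (wedge_eq0 f_immersion f'_immersion g_neq0 S_congruence f_envelopes
  f'_envelopes S_conformal S_ribaucour no_common_umbilic M_connected S_full).
Qed.
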